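(* Admitting a $\mathbf{D}$-Kähler structure implies neither being $\mathcal{C}^\infty$-pure at the $2$-nd stage nor being $\mathcal{C}^\infty$-full at the $2$-nd stage. That is: there exists a compact $\mathbf{D}$-complex manifold $(X,K)$ admitting a $\mathbf{D}$-Kähler structure such that $K$ is not $\mathcal{C}^\infty$-pure at the $2$-nd stage, and there exists a compact $\mathbf{D}$-complex manifold $(X',K')$ admitting a $\mathbf{D}$-Kähler structure such that $K'$ is not $\mathcal{C}^\infty$-full at the $2$-nd stage.
   Context: An almost $\mathbf{D}$-complex structure on a $2n$-dimensional manifold $X$ is $K\in\mathrm{End}(TX)$ with $K^2=\mathrm{id}_{TX}$ whose eigenbundles $T^+X$, $T^-X$ for the eigenvalues $+1,-1$ both have rank $n$. It is integrable (then called $\mathbf{D}$-complex) if $[T^+X,T^+X]\subseteq T^+X$ and $[T^-X,T^-X]\subseteq T^-X$. A $\mathbf{D}$-Kähler structure on a $\mathbf{D}$-complex manifold $(X,K)$ is a $K$-anti-invariant symplectic form, i.e. a symplectic form $\omega$ with $\omega(K\cdot,K\cdot)=-\omega(\cdot,\cdot)$. $K$ acts on $2$-forms by $(K\alpha)(\cdot,\cdot)=\alpha(K\cdot,K\cdot)$. Set $H^{2\,\pm}_K(X;\mathbb{R})=\{[\alpha]\in H^2_{dR}(X;\mathbb{R}) : \alpha \text{ a closed } 2\text{-form with } K\alpha=\pm\alpha\}$. $K$ is $\mathcal{C}^\infty$-pure at the $2$-nd stage if $H^{2\,+}_K(X;\mathbb{R})\cap H^{2\,-}_K(X;\mathbb{R})=\{0\}$,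 and $\mathcal{C}^\infty$-full at the $2$-nd stage if $H^{2\,+}_K(X;\mathbb{R})+H^{2\,-}_K(X;\mathbb{R})=H^2_{dR}(X;\mathbb{R})$. *)

(* Defs.v *)
From HB Require Import structures.
From mathcomp Require Import all_boot all_order all_algebra.
From mathcomp Require Import all_classical all_reals all_analysis.

Set Implicit Arguments.
Unset Strict Implicit.
Unset Printing Implicit Defensive.

Import Order.TTheory GRing.Theory Num.Theory.
Import numFieldNormedType.Exports.

Local Open Scope classical_set_scope.
Local Open Scope ring_scope.

(** Smooth manifolds are given by an atlas, and tensor fields by their
    components in the charts of the atlas, subject to the usual transformation
    law on overlaps. Tangent vectors are row vectors, so that a linear map acts
    by multiplication on the right: K v is [v *m K], and the bilinear form with
    Gram matrix A is [(v *m A *m w^T) 0 0]. *)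

Section Smooth.
Variables (R : realType) (m : nat).

Definition partial (j : 'I_m) (f : 'rV[R]_m -> R) : 'rV[R]_m -> R :=
  fun x => 'D_(delta_mx 0 j) f x.

(* Meant for an open set A. *)
Fixpoint Ck (k : nat) (A : set 'rV[R]_m) (f : 'rV[R]_m -> R) : Prop :=
  {in A, continuous f} /\
  (if k is k'.+1 then
     forall j, (forall x, A x -> derivable f x (delta_mx 0 j)) /\
               Ck k' A (partial j f)
   else True).

Definition smooth_on (A : set 'rV[R]_m) (f : 'rV[R]_m -> R) : Prop :=
  forall k, Ck k A f.

Definition smooth_mx_on p q (A : set 'rV[R]_m) (F : 'rV[R]_m -> 'M[R]_(p, q))
    : Prop :=
  forall a b, smooth_on A (fun x => F x a b).

End Smooth.

Section Manifold.
Variables (R : realType) (m : nat).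

(* A homeomorphism from an open subset of T onto an open subset of R^m; the
   values of chart_map and chart_inv outside these sets are irrelevant. *)
Record chart (T : topologicalType) := Chart {
  chart_dom : set T;
  chart_map : T -> 'rV[R]_m;
  chart_inv : 'rV[R]_m -> T;
  chart_dom_open : open chart_dom;
  chart_img_open : open (chart_map @` chart_dom);
  chart_mapK : {in chart_dom, cancel chart_map chart_inv};
  chart_map_continuous : {in chart_dom, continuous chart_map};
  chart_inv_continuous : {in chart_map @` chart_dom, continuous chart_inv}
}.

Definition chart_img T (c : chart T) : set 'rV[R]_m :=
  chart_map c @` chart_dom c.

Definition overlap T (c c' : chart T) : set 'rV[R]_m :=
  chart_map c @` (chart_dom c `&` chart_dom c').

Definition transition T (c c' : chart T) : 'rV[R]_m -> 'rV[R]_m :=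
  chart_map c' \o chart_inv c.

Record manifold := Manifold {
  man_carrier :> topologicalType;
  man_hausdorff : hausdorff_space man_carrier;
  man_second_countable : @second_countable man_carrier;
  man_index : Type;
  man_chart : man_index -> chart man_carrier;
  man_cover : forall p, exists i, chart_dom (man_chart i) p;
  man_smooth : forall i j,
    smooth_mx_on (overlap (man_chart i) (man_chart j))
                 (transition (man_chart i) (man_chart j))
}.

End Manifold.

Section Tensors.
Variables (R : realType) (m : nat) (X : manifold R m).

Let I := man_index X.
Let img (i : I) := chart_img (man_chart i).
Let ovl (i j : I) := overlap (man_chart i) (man_chart j).
Let tr (i j : I) := transition (man_chart i) (man_chart j).
(* Row convention: [v *m J i j x] is the differential of tr i j at x along v. *)
Let J (i j : I) (x : 'rV[R]_m) : 'M[R]_m := jacobian (tr i j) x.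

(* Only the values of [F i] on [img i] are meaningful. *)
Definition components p q : Type := man_index X -> 'rV[R]_m -> 'M[R]_(p, q).

Definition feq p q (F G : components p q) : Prop :=
  forall i x, img i x -> F i x = G i x.

Definition smooth_components p q (F : components p q) : Prop :=
  forall i, smooth_mx_on (img i) (F i).

Definition is_vector_field (V : components 1 m) : Prop :=
  smooth_components V /\
  forall i j x, ovl i j x -> V j (tr i j x) = V i x *m J i j x.

Definition is_endo (K : components m m) : Prop :=
  smooth_components K /\
  forall i j x, ovl i j x -> J i j x *m K j (tr i j x) = K i x *m J i j x.

Definition is_form1 (b : components 1 m) : Prop :=
  smooth_components b /\
  forall i j x, ovl i j x -> b i x = b j (tr i j x) *m (J i j x)^T.

Definition is_form2 (a : components m m) : Prop :=
  [/\ smooth_components a,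
      forall i x, img i x -> (a i x)^T = - a i x &
      forall i j x, ovl i j x ->
        a i x = J i j x *m a j (tr i j x) *m (J i j x)^T].

Definition lie_bracket (V W : components 1 m) : components 1 m := fun i x =>
  \row_k \sum_j (V i x 0 j * partial j (fun y => W i y 0 k) x
                 - W i x 0 j * partial j (fun y => V i y 0 k) x).

Definition d1 (b : components 1 m) : components m m := fun i x =>
  \matrix_(j, k) (partial j (fun y => b i y 0 k) x
                  - partial k (fun y => b i y 0 j) x).

Definition d2 (a : components m m) (i : man_index X) (x : 'rV[R]_m)
    (j k l : 'I_m) : R :=
  partial j (fun y => a i y k l) x + partial k (fun y => a i y l j) x
  + partial l (fun y => a i y j k) x.

Definition closed2 (a : components m m) : Prop :=
  is_form2 a /\ forall i x, img i x -> forall j k l, d2 a i x j k l = 0.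

Definition exact2 (a : components m m) : Prop :=
  exists2 b, is_form1 b & feq a (d1 b).

(* The de Rham class [a], as a coset of closed 2-forms modulo exact ones. *)
Definition class2 (a : components m m) : set (components m m) :=
  [set a' | closed2 a' /\ exact2 (fun i x => a' i x - a i x)].

Definition H2dR : set (set (components m m)) := [set class2 a | a in closed2].

Definition H2add (S S' : set (set (components m m))) : set (set (components m m)) :=
  [set c | exists a b, [/\ closed2 a /\ S (class2 a),
     closed2 b /\ S' (class2 b) & c = class2 (fun i x => a i x + b i x)]].

Definition act2 (K a : components m m) : components m m :=
  fun i x => K i x *m a i x *m (K i x)^T.

(* H^{2+}_K for s = 1 and H^{2-}_K for s = -1. *)
Definition H2K (K : components m m) (s : R) : set (set (components m m)) :=
  [set class2 a | a in
     [set a | closed2 a /\ feq (act2 K a) (fun i x => s *: a i x)]].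

Definition Cinfty_pure2 (K : components m m) : Prop :=
  H2K K 1 `&` H2K K (-1) = [set class2 (fun _ _ => 0)].

Definition Cinfty_full2 (K : components m m) : Prop :=
  H2add (H2K K 1) (H2K K (-1)) = H2dR.

Definition symplectic (w : components m m) : Prop :=
  closed2 w /\
  forall i x, img i x ->
    forall v : 'rV[R]_m,
      (forall u : 'rV[R]_m, (v *m w i x *m u^T) 0 0 = 0) -> v = 0.

(* The eigenbundle of K for s is stable under the Lie bracket. *)
Definition eigen_involutive (K : components m m) (s : R) : Prop :=
  forall V W : components 1 m, is_vector_field V -> is_vector_field W ->
    feq (fun i x => V i x *m K i x) (fun i x => s *: V i x) ->
    feq (fun i x => W i x *m K i x) (fun i x => s *: W i x) ->
    feq (fun i x => lie_bracket V W i x *m K i x)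
        (fun i x => s *: lie_bracket V W i x).

Definition Dkahler (K w : components m m) : Prop :=
  symplectic w /\ feq (act2 K w) (fun i x => - w i x).

End Tensors.

Section Dcomplex.
Variables (R : realType) (n : nat) (X : manifold R (2 * n)%N).

Definition almost_Dcomplex (K : components X (2 * n)%N (2 * n)%N) : Prop :=
  is_endo K /\
  forall i x, chart_img (man_chart i) x ->
    [/\ K i x *m K i x = 1%:M,
        \rank (eigenspace (K i x) 1) = n &
        \rank (eigenspace (K i x) (-1)) = n].

Definition Dcomplex (K : components X (2 * n)%N (2 * n)%N) : Prop :=
  [/\ almost_Dcomplex K, eigen_involutive K 1 & eigen_involutive K (-1)].

End Dcomplex.

(* Main.v *)
Require Import Defs.
From HB Require Import structures.
From mathcomp Require Import all_boot all_order all_algebra generic_quotient.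
From mathcomp Require Import all_classical all_reals all_analysis.
From mathcomp Require Import ring lra.

(** One example serves both halves: the torus R^4/Z^4 with coordinates x, y, z, w
    and the structure K given by K e_z = e_z, K e_w = - e_w,
    K e_x = k e_x + e_y, K e_y = (1 - k^2) e_x - k e_y, where k is a smooth
    1-periodic function of x alone. The eigenbundles are spanned by
    (k + 1) e_x + e_y, e_z and by (k - 1) e_x + e_y, e_w, and are involutive;
    dx^dy + dz^dw is K-anti-invariant. The function k is chosen to be 1 near
    x = 0 and -1 near x = 1/2, so that e_y is a -1-eigenvector near x = 0 and a
    +1-eigenvector near x = 1/2.

    Not pure: let f(x) >= 0 be a bump supported where k = 1. Then f(x) dx^dz is
    K-invariant, its translate f(x + 1/2) dx^dz is K-anti-invariant, and the two
    differ by d(h dz) with h(x) = - int_0^(1/2) f(x + t) dt. If f(x) dx^dz were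
    db, averaging over z would give a periodic function of x with derivative f,
    which is impossible.

    Not full: the mean over (y, w) of the (y, w)-component of a closed form does
    not depend on x, and it vanishes for exact forms. An invariant form has no
    (y, w)-component on x = 1/2 and an anti-invariant one has none on x = 0, so
    no sum of two such closed forms is cohomologous to dy^dw. *)

Set Implicit Arguments.
Unset Strict Implicit.
Unset Printing Implicit Defensive.

Import Order.TTheory GRing.Theory Num.Theory.
Import numFieldNormedType.Exports.

Local Open Scope classical_set_scope.
Local Open Scope ring_scope.

(** * Smooth functions of one and several variables *)

Section SmoothReal.
Variable R : realType.
Implicit Types (f g : R -> R) (x t : R).

(** One-variable counterpart of [Ck] on the whole line. The coefficients of the structure and of the
    test forms depend on x alone, so products, quotients and compositions are handled here and
    carried to R^m by [Ck_coord]. *)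
Fixpoint C1k (k : nat) f : Prop :=
  continuous f /\
  if k is k'.+1 then (forall x : R, derivable f x 1) /\ C1k k' (derive1 f) else True.

Lemma C1k_cont k f : C1k k f -> continuous f.
Proof. by case: k => [|k] []. Qed.

Lemma C1kW k f : C1k k.+1 f -> C1k k f.
Proof.
elim: k f => [|k IH] f [cf [df /= Cf]]; first by split.
by split=> //; split=> //; apply: IH.
Qed.

Lemma derivable_continuous f : (forall x : R, derivable f x 1) -> continuous f.
Proof. by move=> df x; apply/differentiable_continuous/derivable1_diffP. Qed.

Lemma C1kS k f f' : (forall x : R, is_derive x (1:R) f (f' x)) -> C1k k f' -> C1k k.+1 f.
Proof.
move=> df Cf'; have f'E : derive1 f = f' by apply/funext => x; rewrite derive1E derive_val.
split; first by apply: derivable_continuous => x; have := df x.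
by rewrite f'E; split.
Qed.

Lemma C1k_is_derive k f x : C1k k.+1 f -> is_derive x 1 f ((derive1 f) x).
Proof. by move=> [_ [df _]]; rewrite derive1E; exact/derivableP. Qed.

Lemma C1k_cst k c : C1k k (cst c).
Proof.
elim: k c => [|k IH] c; first by split=> // x; exact: cst_continuous.
apply: (@C1kS _ _ (cst 0)) => // x; exact: is_derive_cst.
Qed.

Lemma C1k_id k : C1k k id.
Proof.
case: k => [|k]; first by split=> // x; exact: cvg_id.
by apply: (@C1kS _ _ (cst 1)); last exact: C1k_cst.
Qed.

Lemma C1kD k f g : C1k k f -> C1k k g -> C1k k (fun x => f x + g x).
Proof.
elim: k f g => [|k IH] f g Cf Cg.
  by split=> // x; apply: continuousD; apply: C1k_cont; eassumption.
apply: (@C1kS _ _ (fun x => (derive1 f) x + (derive1 g) x)).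
  move=> x; have fx := C1k_is_derive x Cf; have gx := C1k_is_derive x Cg.
  exact: is_deriveD.
by apply: IH; [case: Cf => _ []|case: Cg => _ []].
Qed.

Lemma C1kM k f g : C1k k f -> C1k k g -> C1k k (fun x => f x * g x).
Proof.
elim: k f g => [|k IH] f g Cf Cg.
  by split=> // x; apply: continuousM; apply: C1k_cont; eassumption.
apply: (@C1kS _ _ (fun x => f x * (derive1 g) x + g x * (derive1 f) x)).
  move=> x; have fx := C1k_is_derive x Cf; have gx := C1k_is_derive x Cg.
  exact: is_deriveM.
have [_ [_ Cf']] := Cf; have [_ [_ Cg']] := Cg.
by apply: C1kD; apply: IH => //; apply: C1kW.
Qed.

Lemma C1k_comp k f g : C1k k f -> C1k k g -> C1k k (fun x => f (g x)).
Proof.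
elim: k f g => [|k IH] f g Cf Cg.
  split=> // x; apply: (@continuous_comp _ _ _ g f);
    by apply: C1k_cont; eassumption.
apply: (@C1kS _ _ (fun x => (derive1 g) x * (derive1 f) (g x))).
  move=> x; have gx := C1k_is_derive x Cg; have fx := C1k_is_derive (g x) Cf.
  by rewrite mulrC; exact: is_derive1_comp.
have [_ [_ Cf']] := Cf; have [_ [_ Cg']] := Cg.
by apply: C1kM => //; apply: IH => //; apply: C1kW.
Qed.

Lemma C1kV k f : (forall x, f x != 0) -> C1k k f -> C1k k (fun x => (f x)^-1).
Proof.
move=> f0; elim: k => [|k IH] Cf.
  by split=> // x; apply: continuousV => //; exact: (C1k_cont Cf).
apply: (@C1kS _ _ (fun x => (-1) * (((f x)^-1 * (f x)^-1) * (derive1 f) x))).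
  move=> x; have fx := C1k_is_derive x Cf.
  apply: (is_derive_eq (@is_deriveV _ f x _ 1 (f0 x) fx)).
  by rewrite /GRing.scale /= expr2 invfM mulN1r mulNr.
have [_ [_ Cf']] := Cf; have Cfk := C1kW Cf.
by apply: C1kM; [exact: C1k_cst|apply: C1kM => //; apply: C1kM; exact: IH].
Qed.

Lemma C1k_cos_sin k : C1k k cos /\ C1k k sin.
Proof.
elim: k => [|k [Cc Cs]].
  by split; split=> // x; [exact: continuous_cos|exact: continuous_sin].
split.
  apply: (@C1kS _ _ (fun x => (-1) * sin x)).
    by move=> x; rewrite mulN1r; exact: is_derive_cos.
  by apply: C1kM => //; exact: C1k_cst.
by apply: (@C1kS _ _ cos) => // x; exact: is_derive_sin.
Qed.

(** [flat 0] is the classical exp(-1/t) cut off at 0. The powers of 1/t make the family closed under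
    differentiation up to linear combinations, so a single induction on the order proves all members
    smooth. *)
Definition flat (n : nat) (t : R) : R :=
  if 0 < t then t ^- n * expR (- t^-1) else 0.

Lemma flat_gt0 n t : 0 < t -> 0 < flat n t.
Proof. by move=> t0; rewrite /flat t0 mulr_gt0 ?expR_gt0 ?invr_gt0 ?exprn_gt0. Qed.

Lemma flat_eq0 n t : t <= 0 -> flat n t = 0.
Proof. by rewrite /flat leNgt => /negbTE ->. Qed.

Lemma flat_ge0 n t : 0 <= flat n t.
Proof. by case: (ltP 0 t) => [/(flat_gt0 n)/ltW //|/(flat_eq0 n) ->]. Qed.

(* [e^s >= (s/N)^N] with [s = 1/t] and [N = n + 1] *)
Lemma flat_le n t : flat n t <= (n.+1%:R ^+ n.+1) * `|t|.
Proof.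
have [t0|t0] := ltP 0 t; last first.
  by rewrite flat_eq0// mulr_ge0 ?exprn_ge0.
rewrite /flat t0 (gtr0_norm t0).
have e1 : (t^-1 / n.+1%:R) ^+ n.+1 <= expR (t^-1).
  have -> : expR t^-1 = expR (t^-1 / n.+1%:R) ^+ n.+1.
    by rewrite -expRM_natl mulrC divfK.
  have h0 : 0 <= t^-1 / n.+1%:R by rewrite divr_ge0// invr_ge0 ltW.
  apply: lerXn2r; rewrite ?nnegrE ?expR_ge0//.
  by apply: (le_trans _ (expR_ge1Dx _)); rewrite lerDr.
rewrite expRN ler_pdivrMr ?expR_gt0//.
apply: (le_trans _ (ler_wpM2l _ e1)); last by rewrite mulr_ge0 ?exprn_ge0 ?ltW.
have N0 : n.+1%:R ^+ n.+1 != 0 :> R by rewrite expf_neq0// pnatr_eq0.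
rewrite [leRHS](_ : _ = t * t^-1 ^+ n.+1 * (n.+1%:R ^+ n.+1 / n.+1%:R ^+ n.+1));
  last by rewrite expr_div_n; ring.
by rewrite divff// mulr1 exprS mulrA divff ?gt_eqF// mul1r exprVn.
Qed.

Lemma is_derive_flat n t :
  is_derive t 1 (flat n) ((- n%:R) * flat n.+1 t + flat n.+2 t).
Proof.
have [t0|t0|->] := ltgtP t 0.
- rewrite !flat_eq0 ?ltW// mulr0 addr0.
  apply: (@near_eq_is_derive _ _ _ (cst 0)).
    near=> s; rewrite flat_eq0//; near: s.
    exact: lt_le_nbhsl.
- have dV : is_derive t 1 (fun s : R => s^-1) (- t ^- 2).
    apply: (is_derive_eq (@is_deriveV _ id t _ 1 (lt0r_neq0 t0) (is_derive_id _ _))).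
    by rewrite /GRing.scale/= mulr1.
  have dVn : is_derive t 1 (fun s : R => s^-1 ^+ n) (- n%:R * t ^- n.+1).
    rewrite (_ : (fun s : R => _) = (fun s : R => s^-1) ^+ n); last first.
      by apply/funext => s; rewrite fctE.
    apply: (is_derive_eq (@is_deriveX _ _ _ n t 1 _ dV)).
    rewrite /GRing.scale/=; case: n => [|n]; first by rewrite oppr0 !mul0r.
    by rewrite !mulNr mulrN -mulrA -!exprVn -exprD addn2.
  have dE : is_derive t 1 (fun s : R => expR (- s^-1)) (t ^- 2 * expR (- t^-1)).
    have dN := @is_deriveN _ _ _ _ t 1 _ dV.
    apply: (is_derive_eq (@is_derive1_comp _ expR (fun s => - s^-1) t _ _
      (is_derive_expR _) dN)).
    by rewrite opprK mulrC.
  apply: is_derive_eq.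
    apply: (near_eq_is_derive _ (@is_deriveM _ _ _ _ t 1 _ _ dVn dE)).
    near=> s; have s0 : 0 < s by near: s; exact: lt_nbhsr.
    by rewrite /flat s0 fctE exprVn.
  rewrite /flat t0 -!exprVn !exprS expr0 /GRing.scale /=.
  ring.
rewrite !flat_eq0// mulr0 addr0.
have q0 : h^-1 *: ((flat n \o shift 0) (h *: (1:R)) - flat n 0) @[h --> 0^'] --> (0:R).
  set C : R := n.+2%:R ^+ n.+2.
  apply/cvgr0Pnorm_le => e e0.
  have C0 : 0 < C + 1 by rewrite ltr_wpDl ?exprn_ge0.
  near=> h.
  (* At 0 the absolute difference quotient of [flat n] is [flat n.+1 h], on both sides of 0;
     [flat_le] bounds it by [C * |h|]. The bound uses [C + 1] so as to divide by something visibly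
     positive. *)
  have hE : `|h^-1 *: ((flat n \o shift 0) (h *: (1:R)) - flat n 0)| = flat n.+1 h.
    rewrite /= addr0 /GRing.scale /= mulr1 (flat_eq0 n (lexx 0)) subr0.
    have [h0|h0] := ltP 0 h; last by rewrite !flat_eq0// mulr0 normr0.
    rewrite ger0_norm ?mulr_ge0 ?flat_ge0 ?invr_ge0 ?ltW//.
    by rewrite /flat h0 mulrA exprS invfM.
  rewrite hE; apply: (le_trans (flat_le _ _)); rewrite -/C.
  apply: (@le_trans _ _ ((C + 1) * `|h|)); first by rewrite ler_wpM2r// lerDl.
  rewrite mulrC -ler_pdivlMr//; near: h; apply: dnbhs0_le.
  by rewrite divr_gt0.
by apply: DeriveDef; [apply/cvg_ex; exists 0|exact: cvg_lim].
Unshelve. all: by end_near. Qed.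

Lemma C1k_flat k n : C1k k (flat n).
Proof.
elim: k n => [|k IH] n.
  by split=> //; apply: derivable_continuous => x; have := is_derive_flat n x.
apply: (C1kS (is_derive_flat n)); apply: C1kD => //; apply: C1kM => //.
exact: C1k_cst.
Qed.

(** * Periodic profile functions: wave, bump and tilt *)

Lemma periodic_int g : (forall x, g (x + 1) = g x) ->
  forall x z, z \is a Num.int -> g (x + z) = g x.
Proof.
move=> g1 x z /intrP[n ->].
have gn (m : nat) y : g (y + m%:R) = g y.
  by elim: m y => [|m IH] y; rewrite ?addr0// -natr1 addrA g1 IH.
case: n => m; first exact: gn.
by rewrite NegzE mulrNz -(gn m.+1 (x - _)) subrK.
Qed.

Definition wave x : R := cos (2 * pi * x).

(** Source of every symmetry of the example: two half shifts give 1-periodicity, and one half shift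
    negates [tilt], exchanging the roles of the two eigenvalues. *)
Lemma wave_half x : wave (x + 2^-1) = - wave x.
Proof.
rewrite /wave mulrDr (_ : 2 * pi * 2^-1 = pi :> R); last by field.
exact: cosDpi.
Qed.

Lemma C1k_wave k : C1k k wave.
Proof.
apply: C1k_comp; first by case: (C1k_cos_sin k).
by apply: C1kM; [exact: C1k_cst|exact: C1k_id].
Qed.

Definition hump x : R := flat 0 (wave x - 2^-1).

(* The function k of the example: it is 1 as soon as [wave x >= 1/2], in
   particular on the support of [hump], and [-1] as soon as [wave x <= -1/2]. *)
Definition tilt x : R :=
  let p := flat 0 (2^-1 + wave x) in let q := flat 0 (2^-1 - wave x) in
  (p - q) / (p + q).

Let C1k_flat_affine k (a b : R) : C1k k (fun x => flat 0 (a + b * wave x)).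
Proof.
apply: C1k_comp; first exact: C1k_flat.
by apply: C1kD; [|apply: C1kM; [|exact: C1k_wave]]; exact: C1k_cst.
Qed.

Lemma C1k_hump k : C1k k hump.
Proof.
rewrite (_ : hump = fun x => flat 0 (- 2^-1 + 1 * wave x)).
  exact: C1k_flat_affine.
by apply/funext => x; rewrite /hump mul1r addrC.
Qed.

Lemma C1k_tilt k : C1k k tilt.
Proof.
pose p x := flat 0 (2^-1 + 1 * wave x); pose q x := flat 0 (2^-1 + (-1) * wave x).
have Cp : C1k k p by exact: C1k_flat_affine.
have Cq : C1k k q by exact: C1k_flat_affine.
rewrite (_ : tilt = fun x => (p x + (-1) * q x) * (p x + q x)^-1); last first.
  by apply/funext => x; rewrite /tilt /p /q !mul1r !mulN1r.
have C1 : C1k k (cst (-1)) by exact: C1k_cst.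
apply: C1kM; first by apply: C1kD => //; apply: C1kM.
apply: C1kV; last exact: C1kD.
move=> x; apply: lt0r_neq0; rewrite /p /q mul1r mulN1r.
(* The denominator is positive because [1/2 + wave x] and [1/2 - wave x] are never both nonpositive;
   the sign of [wave x] tells which summand is positive. *)
have [w0|w0] := lerP 0 (wave x).
  by rewrite ltr_pwDl ?flat_ge0// flat_gt0//; lra.
by rewrite ltr_wpDl ?flat_ge0// flat_gt0//; lra.
Qed.

Lemma hump_ge0 x : 0 <= hump x. Proof. exact: flat_ge0. Qed.

Lemma hump0_gt0 : 0 < hump 0.
Proof. by rewrite flat_gt0// /wave mulr0 cos0; lra. Qed.

Lemma humpD1 x : hump (x + 1) = hump x.
Proof.
by rewrite /hump (splitr 1) mul1r addrA !wave_half opprK.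
Qed.

Lemma tilt_half x : tilt (x + 2^-1) = - tilt x.
Proof.
by rewrite /tilt wave_half opprK -mulNr opprB [flat _ _ + flat _ _]addrC.
Qed.

Lemma tiltD1 x : tilt (x + 1) = tilt x.
Proof. by rewrite (splitr 1) mul1r addrA !tilt_half opprK. Qed.

Lemma tilt_hump x : hump x != 0 -> tilt x = 1.
Proof.
move=> bx; have w : 2^-1 < wave x.
  by rewrite ltNge; apply: contra bx => h; rewrite /hump flat_eq0//; lra.
have -> : tilt x = (flat 0 (2^-1 + wave x) - 0) / (flat 0 (2^-1 + wave x) + 0).
  by rewrite /tilt (@flat_eq0 0 (2^-1 - wave x)); last lra.
by rewrite subr0 addr0 divff// lt0r_neq0// flat_gt0//; lra.
Qed.

Lemma tilt0 : tilt 0 = 1.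
Proof. by rewrite tilt_hump// lt0r_neq0// hump0_gt0. Qed.

End SmoothReal.

(** * Smooth functions on open subsets of R^m *)

Section SmoothRV.
Variables (R : realType) (m : nat).
Implicit Types (f g : 'rV[R]_m -> R) (A U : set 'rV[R]_m) (x : 'rV[R]_m).

Lemma Ck_continuous k A f : Ck k A f -> {in A, continuous f}.
Proof. by case: k => [|k] []. Qed.

Lemma Ck_subset k A U f : U `<=` A -> Ck k A f -> Ck k U f.
Proof.
move=> UA; elim: k f => [|k IH] f [cf df].
  by split=> // x /set_mem/UA/mem_set; exact: cf.
split=> [x /set_mem/UA/mem_set|j]; first exact: cf.
have [dj Cj] := df j; split; last exact: IH.
by move=> x /UA; exact: dj.
Qed.

Lemma near_eq_partial (j : 'I_m) f g x :
  {near x, f =1 g} -> partial j f x = partial j g x.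
Proof. exact: near_eq_derive. Qed.

Lemma open_eq_near A f g x : open A -> A x -> {in A, f =1 g} -> {near x, f =1 g}.
Proof.
move=> oA Ax fg; have := open_nbhs_nbhs (conj oA Ax).
by apply: filterS => y Ay; apply: fg; exact: mem_set.
Qed.

Lemma near_eq_continuous_at f g x : {near x, f =1 g} ->
  {for x, continuous f} -> {for x, continuous g}.
Proof.
move=> fg cf; rewrite /prop_for /continuous_at -(nbhs_singleton fg).
apply: cvg_trans cf; exact: (near_eq_cvg fg).
Qed.

Lemma Ck_local k A f :
  (forall x, A x -> exists U, [/\ open U, U x & Ck k U f]) -> Ck k A f.
Proof.
elim: k f => [|k IH] f H.
  split=> // x /set_mem Ax; have [U [oU Ux CU]] := H _ Ax.
  exact: (Ck_continuous CU (mem_set Ux)).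
split=> [x /set_mem Ax|j].
  by have [U [oU Ux CU]] := H _ Ax; exact: (Ck_continuous CU (mem_set Ux)).
split=> [x /H[U [_ Ux [_ df]]]|]; first by have [+ _] := df j; exact.
by apply: IH => x /H[U [oU Ux [_ df]]]; exists U; split=> //; have [] := df j.
Qed.

Lemma Ck_eq k A f g : open A -> {in A, f =1 g} -> Ck k A f -> Ck k A g.
Proof.
move=> oA; elim: k f g => [|k IH] f g fg [cf df].
  split=> // x xA; have Ax := set_mem xA.
  exact: near_eq_continuous_at (open_eq_near oA Ax fg) (cf x xA).
split=> [x xA|j].
  have Ax := set_mem xA.
  exact: near_eq_continuous_at (open_eq_near oA Ax fg) (cf x xA).
have [dj Cj] := df j; split=> [x Ax|].
  by apply: near_eq_derivable (dj x Ax); exact: open_eq_near fg.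
apply: IH Cj => x /set_mem Ax.
by apply: near_eq_partial; exact: open_eq_near fg.
Qed.

Lemma partialD j f g x : derivable f x (delta_mx 0 j) ->
  derivable g x (delta_mx 0 j) ->
  partial j (fun y => f y + g y) x = partial j f x + partial j g x.
Proof. exact: deriveD. Qed.

Lemma CkD k A f g : open A -> Ck k A f -> Ck k A g -> Ck k A (fun x => f x + g x).
Proof.
move=> oA; elim: k f g => [|k IH] f g [cf df] [cg dg].
  by split=> // x xA; apply: continuousD; [exact: cf|exact: cg].
split=> [x xA|j]; first by apply: continuousD; [exact: cf|exact: cg].
have [dfj Cfj] := df j; have [dgj Cgj] := dg j.
split=> [x Ax|]; first by apply: derivableD; [exact: dfj|exact: dgj].
apply: Ck_eq (IH _ _ Cfj Cgj) => // x /set_mem Ax.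
by rewrite partialD//; [exact: dfj|exact: dgj].
Qed.

Lemma partialZ j c f x : derivable f x (delta_mx 0 j) ->
  partial j (fun y => c * f y) x = c * partial j f x.
Proof. exact: deriveZ. Qed.

Lemma CkZ k A c f : open A -> Ck k A f -> Ck k A (fun x => c * f x).
Proof.
move=> oA; elim: k f => [|k IH] f [cf df].
  by split=> // x xA; apply: continuousM; [exact: cst_continuous|exact: cf].
split=> [x xA|j].
  by apply: continuousM; [exact: cst_continuous|exact: cf].
have [dfj Cfj] := df j.
split=> [x Ax|]; first by apply: derivableZ; exact: dfj.
apply: Ck_eq (IH _ Cfj) => // x /set_mem Ax.
by rewrite partialZ//; exact: dfj.
Qed.

Lemma Ck_partial k A f j : Ck k.+1 A f -> Ck k A (partial j f).
Proof. by move=> [_ /(_ j)[]]. Qed.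

Lemma smooth_partial A f j : smooth_on A f -> smooth_on A (partial j f).
Proof. by move=> sf k; exact: Ck_partial. Qed.

Lemma smooth_cst A c : smooth_on A (fun=> c).
Proof.
move=> k; elim: k c => [|k IH] c; first by split=> // x _; exact: cst_continuous.
split=> [x _|j]; first exact: cst_continuous.
split=> [x _|]; first exact: derivable_cst.
by rewrite (_ : partial j _ = fun=> 0)//; apply/funext => x; exact: derive_cst.
Qed.

(** The two difference quotients are the same function of [h], so directional derivatives can be
    computed by one-variable calculus along a line. *)
Lemma is_derive_line f x v (s df : R) :
  is_derive (s *: v + x) v f df <-> is_derive s 1 (fun h => f (h *: v + x)) df.
Proof.
have E : (fun h : R => h^-1 *: (((fun h => f (h *: v + x)) \o shift s) (h *: 1)
      - f (s *: v + x))) =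
    (fun h => h^-1 *: ((f \o shift (s *: v + x)) (h *: v) - f (s *: v + x))).
  by apply/funext => h /=; rewrite [h *: 1]mulr1 scalerDl addrA.
by split=> -[d1 d2]; split; move: d1 d2; rewrite /derivable /derive E.
Qed.

Lemma is_derive_coord (g : R -> R) (dg : R) (i j : 'I_m) x :
  is_derive (x 0 j) 1 g dg ->
  is_derive x (delta_mx 0 i) (fun y => g (y 0 j)) ((i == j)%:R * dg).
Proof.
move=> gx; rewrite -[x]add0r -(scale0r (delta_mx 0 i)); apply/is_derive_line.
have -> : (fun h => g ((h *: delta_mx 0 i + x) 0 j)) =
    g \o (fun h => (i == j)%:R * h + x 0 j).
  by apply/funext => h /=; rewrite !mxE eqxx eq_sym mulrC.
rewrite mulrC; apply: is_derive1_comp; first by rewrite mulr0 add0r.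
have H := is_deriveD (is_deriveZ ((i == j)%:R : R) (is_derive_id (0 : R) (1 : R)))
  (is_derive_cst (x 0 j) (0 : R) 1).
by apply: (is_derive_eq H); rewrite addr0 /GRing.scale/= mulr1.
Qed.

(** The constant [c] makes the induction go through: differentiating along [i] multiplies it by the
    Kronecker symbol of [i] and [j]. *)
Lemma Ck_coord k A (g : R -> R) (c : R) j :
  C1k k g -> Ck k A (fun x => c * g (x 0 j)).
Proof.
elim: k g c => [|k IH] g c Cg.
  split=> // x _; apply: continuousM; first exact: cst_continuous.
  apply: (@continuous_comp _ _ _ (fun y : 'rV[R]_m => y 0 j) g); first exact: coord_continuous.
  exact: (C1k_cont Cg).
have der i x : is_derive x (delta_mx 0 i) (fun x : 'rV[R]_m => c * g (x 0 j))
    (c * (i == j)%:R * derive1 g (x 0 j)).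
  have H := is_derive_coord i (C1k_is_derive (x 0 j) Cg).
  by apply: (is_derive_eq (is_deriveZ c H)); rewrite /GRing.scale/= mulrA.
split=> [x _|i].
  apply: continuousM; first exact: cst_continuous.
  apply: (@continuous_comp _ _ _ (fun y : 'rV[R]_m => y 0 j) g); first exact: coord_continuous.
  exact: (C1k_cont Cg).
split=> [x _|]; first by have := der i x.
rewrite (_ : partial i _ = fun x => c * (i == j)%:R * derive1 g (x 0 j)).
  by apply: IH; case: Cg => _ [].
by apply/funext => x; rewrite /partial derive_val.
Qed.

Lemma smooth_coord A (g : R -> R) j :
  (forall k, C1k k g) -> smooth_on A (fun x => g (x 0 j)).
Proof.
move=> Cg k; rewrite (_ : (fun x => _) = fun x => 1 * g (x 0 j)); first exact: Ck_coord.
by apply/funext => x; rewrite mul1r.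
Qed.

Lemma partial_coord (g : R -> R) i j x : (forall k, C1k k g) ->
  partial i (fun y => g (y 0 j)) x = (i == j)%:R * derive1 g (x 0 j).
Proof.
move=> Cg; have H := is_derive_coord i (C1k_is_derive (x 0 j) (Cg 1%N)).
by rewrite /partial derive_val.
Qed.

End SmoothRV.

(** * Integration along a coordinate direction *)

Section Mean.
Variables (R : realType) (m : nat) (i : 'I_m) (L : R).
Hypothesis L_gt0 : 0 < L.
Implicit Types (u : 'rV[R]_m -> R) (x : 'rV[R]_m).
Local Notation mu := (@lebesgue_measure R).

(** The integral is not divided by [L]. With [L = 1] it is the average over a circle of the torus;
    [L = 1/2] serves to build the primitive [gap]. *)
Definition mean u x : R := \int[mu]_(t in `[0, L]) u (x + t *: delta_mx 0 i).

Lemma continuous_shift u x : continuous u ->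
  continuous (fun t : R => u (x + t *: delta_mx 0 i)).
Proof.
move=> cu t; apply: (@continuous_comp _ _ _ (fun t : R => x + t *: delta_mx 0 i) u);
  last exact: cu.
apply: (@continuousD _ _ _ (cst x)); first exact: cst_continuous.
exact: scalel_continuous.
Qed.

Lemma integrable_shift u x : continuous u ->
  mu.-integrable `[0, L] (EFin \o (fun t : R => u (x + t *: delta_mx 0 i))).
Proof.
move=> cu; apply: continuous_compact_integrable; first exact: segment_compact.
by apply: continuous_subspaceT; exact: continuous_shift.
Qed.

Lemma fine_mu_0L : fine (mu `[0, L]) = L.
Proof. by rewrite lebesgue_measure_itv /= lte_fin L_gt0 oppr0 addr0. Qed.

Lemma mean_continuous u : continuous u -> continuous (mean u).
Proof.
move=> cu x; apply/(@cvgrPdist_le _ _ _ (nbhs x)) => e e0.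
(* Compactness of the segment makes the estimate by [e / L] uniform in [t], for [y] in one
   neighbourhood of [x]. *)
have /compact_near_coveringP cov := @segment_compact R 0 L.
have eL : 0 < e / L by rewrite divr_gt0.
pose P (y : 'rV[R]_m) (t : R) :=
  `|u (x + t *: delta_mx 0 i) - u (y + t *: delta_mx 0 i)| <= e / L.
have : \forall y \near x, `[0, L] `<=` P y.
  apply: (cov _ (nbhs x) P (nbhs_filter x)) => t _.
  pose H (q : R * 'rV[R]_m) := u (x + q.1 *: delta_mx 0 i) - u (q.2 + q.1 *: delta_mx 0 i).
  have cH : {for (t, x), continuous H}.
    apply: continuousB; apply: (@continuous_comp _ _ _ _ u); try exact: cu.
    - by apply: (@continuousD _ _ _ (cst x)); [exact: cst_continuous|];
        apply: continuousZr_tmp; exact: cvg_fst.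
    - by apply: (@continuousD _ _ _ snd); [exact: cvg_snd|];
        apply: continuousZr_tmp; exact: cvg_fst.
  move/cvgrPdist_le : cH => /(_ _ eL).
  apply: filterS => q /=.
  by rewrite {1}/H /= subrr sub0r normrN.
apply: filterS => y Py.
have ix := integrable_shift x cu; have iy := integrable_shift y cu.
rewrite /mean -RintegralB//.
have iB : mu.-integrable `[0, L]
    (EFin \o (fun t : R => u (x + t *: delta_mx 0 i) - u (y + t *: delta_mx 0 i))).
  apply: continuous_compact_integrable; first exact: segment_compact.
  by apply: continuous_subspaceT => t; apply: continuousB; exact: continuous_shift.
apply: (le_trans (le_normr_Rintegral _ iB)) => //.
have -> : e = \int[mu]_(t in `[0, L]) (e / L).
  by rewrite Rintegral_cst// fine_mu_0L divfK ?gt_eqF.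
apply: le_Rintegral => //.
- exact: integrable_norm.
- apply: continuous_compact_integrable; first exact: segment_compact.
  by apply: continuous_subspaceT => ?; exact: cst_continuous.
Qed.

Lemma partial_line u j x (s : R) : Ck 1 setT u ->
  is_derive s 1 (fun h => u (h *: delta_mx 0 j + x)) (partial j u (s *: delta_mx 0 j + x)).
Proof.
move=> [_ /(_ j)[du _]]; apply/is_derive_line/derivableP; exact: du.
Qed.

Lemma Ck_contT k u : Ck k setT u -> continuous u.
Proof. by move=> /Ck_continuous cu x; apply: cu; rewrite inE. Qed.

Lemma is_derive_mean u j x : Ck 1 setT u ->
  is_derive x (delta_mx 0 j) (mean u) (mean (partial j u) x).
Proof.
move=> Cu; have cu := Ck_contT Cu; have cpu := Ck_contT (Ck_partial j Cu).
rewrite -[x]add0r -(scale0r (delta_mx 0 j)); apply/is_derive_line; rewrite scale0r add0r.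
pose f (h t : R) := u (h *: delta_mx 0 j + (x + t *: delta_mx 0 i)).
pose D (q : R * R) : R := `|partial j u (q.1 *: delta_mx 0 j + (x + q.2 *: delta_mx 0 i))|.
have df (h t : R) : is_derive h 1 (f ^~ t)
    (partial j u (h *: delta_mx 0 j + (x + t *: delta_mx 0 i))).
  exact: partial_line.
have cD : continuous D.
  pose A (q : R * R) := q.1 *: delta_mx 0 j + (x + q.2 *: delta_mx 0 i) : 'rV[R]_m.
  have cA : continuous A.
    move=> q; apply: (@continuousD _ _ _ (fun q : R * R => q.1 *: delta_mx 0 j)).
      by apply: continuousZr_tmp; exact: cvg_fst.
    apply: (@continuousD _ _ _ (fun _ : R * R => x)); first exact: cst_continuous.
    by apply: continuousZr_tmp; exact: cvg_snd.
  move=> q; apply: (@continuous_comp _ _ _ (partial j u \o A) (fun r : R => `|r|)).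
    by apply: (@continuous_comp _ _ _ A (partial j u)); [exact: cA|exact: cpu].
  exact: norm_continuous.
(* The constant that dominates the derivative under the integral sign is the maximum of [D] on the
   compact rectangle [-1, 1] x [0, L]. *)
have [|||q Kq Dq] := @compact_EVT_max _ R D (`[-1, 1] `*` `[0, L]).
- by exists (0, 0); split => /=; rewrite in_itv/= ?lerN10 ?ler01 ?lexx ?ltW.
- by apply: compact_setX; exact: segment_compact.
- exact: continuous_subspaceT.
have I0 : `]-1, 1[%classic (0 : R) by rewrite /= in_itv/= ltrN10 ltr01.
have fE (h : R) : \int[mu]_(t in `[0, L]) f h t = mean u (h *: delta_mx 0 j + x).
  by apply: eq_Rintegral => t _; rewrite /f addrA.
have mE t : partial1of2 f 0 t = partial j u (x + t *: delta_mx 0 i).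
  by rewrite partial1of2E derive_val scale0r add0r.
have h1 (h : R) : `]-1, 1[%classic h -> mu.-integrable `[0, L] (EFin \o f h).
  move=> _; rewrite (_ : f h = fun t => u (h *: delta_mx 0 j + x + t *: delta_mx 0 i)).
    exact: integrable_shift.
  by apply/funext => t; rewrite /f addrA.
have h2 (h t : R) : `]-1, 1[%classic h -> `[0, L]%classic t -> derivable (f ^~ t) h 1.
  by move=> _ _; have := df h t.
have h3 (h t : R) : `]-1, 1[%classic h -> `[0, L]%classic t ->
    `|partial1of2 f h t| <= cst (D q) t.
  move=> hI tI; rewrite partial1of2E derive_val; apply: (Dq (h, t)).
  by rewrite inE; split => //=; apply: subset_itv_oo_cc.
have iG : mu.-integrable `[0, L] (EFin \o cst (D q)).
  apply: continuous_compact_integrable; first exact: segment_compact.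
  by apply: continuous_subspaceT => ?; exact: cst_continuous.
have G0 (t : R) : 0 <= cst (D q) t :> R by exact: normr_ge0.
rewrite (_ : (fun h => _) = (fun h => \int[mu]_(t in `[0, L]) f h t)); last first.
  by apply/funext => h; rewrite fE.
have mL : measurable (`[0, L]%classic : set (measurableTypeR R)) by [].
have Hd := derivable_under_integral mL I0 h1 h2 G0 iG h3.
apply: DeriveDef; first exact: Hd.
rewrite -derive1E (differentiation_under_integral mL I0 h1 h2 G0 iG h3).
by apply: eq_Rintegral => t _; exact: mE.
Qed.

Lemma partial_mean u j x : Ck 1 setT u -> partial j (mean u) x = mean (partial j u) x.
Proof. by move=> /(is_derive_mean j x) ?; rewrite /partial derive_val. Qed.

Lemma smooth_mean u : smooth_on setT u -> smooth_on setT (mean u).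
Proof.
move=> su k; elim: k u su => [|k IH] u su.
  by split=> // x _; apply: mean_continuous; exact: Ck_contT (su 0%N).
split=> [x _|j]; first by apply: mean_continuous; exact: Ck_contT (su 0%N).
split=> [x _|]; first by have := is_derive_mean j x (su 1%N).
rewrite (_ : partial j _ = mean (partial j u)); first by apply: IH; exact: smooth_partial.
by apply/funext => x; apply: partial_mean; exact: su.
Qed.

(** The fundamental theorem of calculus along direction [i]. The right-hand side vanishes when [L]
    is a period, and is a half-shift difference when [L = 1/2]. *)
Lemma mean_partial_self u x : Ck 1 setT u ->
  mean (partial i u) x = u (x + L *: delta_mx 0 i) - u x.
Proof.
move=> Cu; have cu := Ck_contT Cu; have cpu := Ck_contT (Ck_partial i Cu).
pose F (t : R) := u (t *: delta_mx 0 i + x).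
have dF (t : R) : is_derive t 1 F (partial i u (t *: delta_mx 0 i + x)) by exact: partial_line.
have cF : continuous F.
  by apply: derivable_continuous => t; have := dF t.
rewrite /mean /Rintegral (continuous_FTC2 L_gt0 (F := F)).
- by rewrite /F scale0r add0r [x + _]addrC.
- by apply: continuous_subspaceT; exact: continuous_shift.
- split.
  + by move=> t _; have := dF t.
  + by apply: cvg_at_right_filter; exact: cF.
  + by apply: cvg_at_left_filter; exact: cF.
- by move=> t _; rewrite derive1E derive_val addrC.
Qed.

Lemma meanD u v x : continuous u -> continuous v ->
  mean (fun y => u y + v y) x = mean u x + mean v x.
Proof. by move=> cu cv; rewrite /mean RintegralD//; exact: integrable_shift. Qed.

Lemma mean_cst c x : mean (cst c) x = c * L.
Proof. by rewrite /mean Rintegral_cst// fine_mu_0L. Qed.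

End Mean.

(** * The torus R^m/Z^m *)

Section Torus.
Variables (R : realType) (m : nat).
Implicit Types x y z u v n : 'rV[R]_m.

Lemma coord_le_norm x i : `|x 0 i| <= `|x|.
Proof.
rewrite /Num.Def.normr/= mx_normrE.
exact: (le_bigmax _ (fun ij : 'I_1 * 'I_m => `|x ij.1 ij.2|) (0, i)).
Qed.

Definition lattice x : bool := [forall i, x 0 i \is a Num.int].

Lemma lattice0 : lattice 0. Proof. by apply/forallP => i; rewrite mxE rpred0. Qed.

Lemma latticeN n : lattice (- n) = lattice n.
Proof. by apply/eq_forallb => i; rewrite mxE rpredN. Qed.

Lemma latticeD n n' : lattice n -> lattice n' -> lattice (n + n').
Proof.
move=> /forallP ln /forallP ln'; apply/forallP => i.
by rewrite mxE rpredD.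
Qed.

Lemma lattice_delta j : lattice (delta_mx 0 j).
Proof. by apply/forallP => i; rewrite mxE; case: (_ && _); rewrite ?rpred0 ?rpred1. Qed.

Lemma lattice_norm_lt1 n : lattice n -> `|n| < 1 -> n = 0.
Proof.
move=> /forallP ln n1; apply/rowP => i; rewrite mxE; apply/eqP.
apply: contraTT n1 => ni0; rewrite -leNgt; apply: le_trans (coord_le_norm _ i).
exact: norm_intr_ge1.
Qed.

Definition lattice_rel x y := lattice (x - y).

Lemma lattice_rel_equiv : equiv_class_of lattice_rel.
Proof.
split=> [x|x y|y x z]; rewrite /lattice_rel.
- by rewrite subrr lattice0.
- by rewrite -latticeN opprB.
- by move=> xy yz; rewrite -(subrKA y) latticeD.
Qed.

Canonical lattice_equiv := EquivRelPack lattice_rel_equiv.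

Definition torus := {eq_quot lattice_equiv}%qT.
HB.instance Definition _ := Choice.on torus.
Definition tpi x : torus := \pi_{eq_quot lattice_equiv}%qT x.
HB.instance Definition _ := isPointed.Build torus (tpi 0).

Lemma tpi_eq x y : (tpi x = tpi y) <-> lattice (x - y).
Proof.
split=> [/eqP|h]; first by rewrite eqmodE.
by apply/eqP; rewrite eqmodE.
Qed.

Lemma tpi_surj (p : torus) : exists x, tpi x = p.
Proof. by exists (repr p); rewrite /tpi reprK. Qed.

(** Balls of the quotient distance between cosets of Z^m. *)
Definition tball (p : torus) (e : R) (q : torus) : Prop :=
  exists x y, [/\ tpi x = p, tpi y = q & `|x - y| < e].

(** The norm is translation invariant, so the representative of the centre can be prescribed; this
    is what makes the triangle inequality work. *)
Lemma tballP x e q : tball (tpi x) e q <-> exists2 y, tpi y = q & `|x - y| < e.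
Proof.
split=> [[x' [y' [/tpi_eq xx' <- d]]]|[y <- d]]; last by exists x, y.
exists (y' + (x - x')); last first.
  by rewrite opprD opprB addrCA [x + _]addrCA subrr addr0 addrC.
by apply/tpi_eq; rewrite addrC addKr -latticeN opprB.
Qed.

Let tball_center p (e : R) : 0 < e -> tball p e p.
Proof.
by move=> e0; have [x <-] := tpi_surj p; exists x, x; rewrite subrr normr0.
Qed.

Let tball_sym p q (e : R) : tball p e q -> tball q e p.
Proof. by move=> [x [y [<- <- d]]]; exists y, x; rewrite distrC. Qed.

Let tball_triangle p q r (e1 e2 : R) :
  tball p e1 q -> tball q e2 r -> tball p (e1 + e2) r.
Proof.
move=> [x [y [<- <- d1]]] /tballP[z <- d2]; exists x, z; split=> //.
by rewrite -(subrKA y) (le_lt_trans (ler_normD _ _))// ltrD.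
Qed.

(* A pseudometric rather than a bare quotient topology, so that second
   countability follows from compactness. *)
Let tent : set_system (torus * torus) := entourage_ tball.
Let tnbhs (p : torus) := nbhs_ tent p.

HB.instance Definition _ := hasNbhs.Build torus tnbhs.
HB.instance Definition _ := @Nbhs_isPseudoMetric.Build R torus
  tent erefl tball tball_center tball_sym tball_triangle erefl.

Lemma ball_tpi x e : ball (tpi x) e = tpi @` [set y | `|x - y| < e].
Proof.
apply/seteqP; split=> [q /tballP[y yq d]|_ [y d <-]]; first by exists y.
by apply/tballP; exists y.
Qed.

Lemma tpi_continuous : continuous tpi.
Proof.
move=> x; apply/(@cvg_ballP _ _ _ (nbhs x)) => e e0; rewrite ball_tpi.
have := nbhsx_ballx x e e0; rewrite -ball_normE.
by apply: filterS => y; exists y.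
Qed.

Lemma tpi_open (U : set 'rV[R]_m) : open U -> open (tpi @` U).
Proof.
move=> oU; rewrite openE => _ [x Ux <-].
have /nbhs_ballP[e /= e0 eU] : nbhs x U by exact: open_nbhs_nbhs.
apply/nbhs_ballP; exists e => //=; rewrite ball_tpi; apply: image_subset.
by move=> y d; apply: eU; rewrite -ball_normE.
Qed.

(** The integers are closed. If [r] differs from an integer [n] within 1/2 of it, a strictly closer
    integer would be at distance less than 1 from [n], hence equal to [n]. *)
Lemma int_approx (r : R) :
  (forall e, 0 < e -> exists2 n, n \is a Num.int & `|r - n| < e) ->
  r \is a Num.int.
Proof.
move=> H; have [n nint rn] := H 2^-1 ltac:(lra).
have [-> //|rn0] := eqVneq r n.
have [|n' n'int] := H (Num.min 2^-1 `|r - n|).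
  by rewrite lt_min normr_gt0 subr_eq0 rn0 andbT; lra.
rewrite lt_min => /andP[rn' rn'n].
have : `|n - n'| < 1.
  rewrite -(subrKA r) (le_lt_trans (ler_normD _ _))// (splitr 1) mul1r distrC.
  by rewrite ltrD// distrC.
have [nn'|nn'] := eqVneq n n'; first by rewrite nn' ltxx in rn'n.
by rewrite ltNge norm_intr_ge1 ?rpredB ?subr_eq0.
Qed.

Lemma torus_hausdorff : hausdorff_space torus.
Proof.
move=> p q pq; have [x xp] := tpi_surj p; have [y yq] := tpi_surj q.
rewrite -xp -yq; apply/tpi_eq/forallP => i; rewrite !mxE; apply: int_approx => e e0.
have e2 : 0 < e / 2 by lra.
have [r [pr /ball_sym qr]] := pq _ _ (nbhsx_ballx p (e / 2) e2) (nbhsx_ballx q (e / 2) e2).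
have := ball_triangle pr qr; rewrite -xp -splitr => /tballP[z].
rewrite -yq => /tpi_eq/forallP/(_ i) zy xz; exists (z 0 i - y 0 i).
  by move: zy; rewrite !mxE.
rewrite opprB addrA subrK; apply: le_lt_trans xz.
by have := coord_le_norm (x - z) i; rewrite !mxE.
Qed.

Lemma torus_compact : compact [set: torus].
Proof.
(* The closed unit cube maps onto the torus: subtract the floor of each coordinate. *)
pose cube := [set x : 'rV[R]_m | forall i, `[0, 1]%classic (x ord0 i)].
have ccube : compact cube.
  by apply: (@rV_compact R m (fun=> `[0, 1]%classic)) => _; exact: segment_compact.
have -> : [set: torus] = tpi @` cube.
  apply/seteqP; split=> // p _; have [x <-] := tpi_surj p.
  exists (\row_i (x 0 i - (Num.floor (x 0 i))%:~R)) => [i|].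
    rewrite /= mxE in_itv/= subr_ge0 floor_le_tmp lerBlDl ltW//.
    by rewrite -intrD1 floorD1_gt.
  apply/tpi_eq/forallP => i; rewrite !mxE addrC addKr rpredN.
  by apply/intrP; eexists.
by apply: continuous_compact => //; apply: continuous_subspaceT; exact: tpi_continuous.
Qed.

(** An open cube of side 1, as the norm is the maximum norm. Two of its points are less than 1
    apart, so [tpi] is injective on it; the atlas has one such chart around every point of R^m. *)
Definition box u : set 'rV[R]_m := ball u 2^-1.

Lemma box_open u : open (box u). Proof. exact: ball_open. Qed.

Lemma box_center u : box u u. Proof. by apply: ballxx; lra. Qed.

Lemma box_norm u x : box u x <-> `|u - x| < 2^-1.
Proof. by rewrite /box -ball_normE. Qed.

Lemma tpi_box_inj u x y : box u x -> box u y -> tpi x = tpi y -> x = y.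
Proof.
move=> /box_norm ux /box_norm uy /tpi_eq xy; apply/eqP; rewrite -subr_eq0; apply/eqP.
apply: lattice_norm_lt1 => //; rewrite -(subrKA u) (splitr 1) mul1r.
by rewrite (le_lt_trans (ler_normD _ _))// ltrD// distrC.
Qed.

(* The representative of [p] in the unit cube around [u]; [0] when there is none. *)
Definition tchart_map u (p : torus) : 'rV[R]_m := xget 0 [set x | box u x /\ tpi x = p].

Lemma tchart_mapE u x : box u x -> tchart_map u (tpi x) = x.
Proof.
move=> ux; rewrite /tchart_map; case: xgetP => [y _ [uy yx]|/(_ x)[]//].
exact: tpi_box_inj uy ux yx.
Qed.

Lemma tchart_img u : tchart_map u @` (tpi @` box u) = box u.
Proof.
apply/seteqP; split=> [_ [_ [x ux <-] <-]|x ux]; first by rewrite tchart_mapE.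
by exists (tpi x); [exists x|exact: tchart_mapE].
Qed.

Lemma tchart_img_open u : open (tchart_map u @` (tpi @` box u)).
Proof. by rewrite tchart_img; exact: box_open. Qed.

Lemma tchart_mapK u : {in tpi @` box u, cancel (tchart_map u) tpi}.
Proof. by move=> _ /set_mem[x ux <-]; rewrite tchart_mapE. Qed.

Lemma tchart_map_continuous u : {in tpi @` box u, continuous (tchart_map u)}.
Proof.
move=> _ /set_mem[x ux <-] V; rewrite tchart_mapE// => xV.
have /nbhs_ballP[e /= e0 eV] : nbhs x (V `&` box u).
  by apply: filterI => //; apply: open_nbhs_nbhs; split=> //; exact: box_open.
apply/nbhs_ballP; exists e => //=; rewrite ball_tpi => _ [y xy <-].
have [Vy uy] : (V `&` box u) y by apply: eV; rewrite -ball_normE.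
by rewrite /= tchart_mapE.
Qed.

Definition tchart u : chart R m torus :=
  Chart (tpi_open (@box_open u)) (@tchart_img_open u) (@tchart_mapK u)
    (@tchart_map_continuous u) (fun x _ => @tpi_continuous x).

Lemma tchart_imgE u : chart_img (tchart u) = box u.
Proof. exact: tchart_img. Qed.

Lemma overlapE u v : overlap (tchart u) (tchart v) =
  [set x | box u x /\ exists2 n, lattice n & box v (x + n)].
Proof.
apply/seteqP; split=> [_ [_ [[x ux <-] [y vy /tpi_eq xy]] <-]|x [ux [n ln vn]]] /=.
  rewrite tchart_mapE//; split=> //; exists (y - x) => //.
  by rewrite addrC subrK.
exists (tpi x); last exact: tchart_mapE.
split; first by exists x.
by exists (x + n) => //; apply/tpi_eq; rewrite addrC addKr.
Qed.

Lemma transitionE u v x n : lattice n -> box v (x + n) ->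
  transition (tchart u) (tchart v) x = x + n.
Proof.
move=> ln vn; rewrite /transition /= (_ : tpi x = tpi (x + n)); first exact: tchart_mapE.
by apply/tpi_eq; rewrite opprD addrA subrr sub0r latticeN.
Qed.

Lemma transition_near u v x n : lattice n -> box v (x + n) ->
  {near x, transition (tchart u) (tchart v) =1 (fun y => y + n)}.
Proof.
move=> ln vn; have c : {for x, continuous (fun y : 'rV[R]_m => y + n)}.
  by apply: continuousD; [exact: cvg_id|exact: cst_continuous].
have : \forall y \near x, box v (y + n).
  by apply: (c (box v)); apply: open_nbhs_nbhs; split=> //; exact: box_open.
by apply: filterS => y; exact: transitionE.
Qed.

(** Near [x] the transition is translation by a fixed lattice vector, so its differential is the
    identity. Consequently the transformation laws of all tensors reduce to invariance under the
    transitions. *)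
Lemma jacobian_transition u v x : overlap (tchart u) (tchart v) x ->
  jacobian (transition (tchart u) (tchart v)) x = 1%:M.
Proof.
rewrite overlapE => -[ux [n ln vn]]; set f := transition _ _.
have fx : {near x, f =1 (fun y => y + n)} by exact: transition_near.
have df : 'd f x = @idfun _ :> ('rV[R]_m -> 'rV[R]_m).
  apply: (@diff_unique _ _ _ f (@idfun _ : {linear 'rV[R]_m -> 'rV[R]_m})).
    by move=> ?; exact: cvg_id.
  apply/eqaddoP => e e0.
  have : \forall y \near (0 : 'rV[R]_m), f (y + x) = y + x + n.
    have c : {for 0, continuous (fun y : 'rV[R]_m => y + x)}.
      by apply: continuousD; [exact: cvg_id|exact: cst_continuous].
    apply: (c [set z | f z = z + n]); rewrite add0r; exact: fx.
  have fxx : f x = x + n by exact: transitionE.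
  apply: filterS => y fy.
  have -> : (f \o shift x - (cst (f x) + @idfun 'rV[R]_m)) y = 0.
    by rewrite !fctE /= fy fxx; apply/eqP; rewrite subr_eq0 -addrA addrC.
  by rewrite normr0 mulr_ge0// ltW.
by apply/matrixP => i j; rewrite mxE df /= !mxE eqxx eq_sym.
Qed.

Lemma transition_smooth u v :
  smooth_mx_on (overlap (tchart u) (tchart v)) (transition (tchart u) (tchart v)).
Proof.
move=> i j k; apply: Ck_local => x uvx.
have : overlap (tchart u) (tchart v) x by [].
rewrite overlapE => -[_ [n ln vn]].
have [U [oU Ux UE]] : exists U, [/\ open U, U x &
    {in U, (fun y => transition (tchart u) (tchart v) y i j) =1 (fun y => y 0 j + n 0 j)}].
  have /nbhs_interior nU := transition_near u ln vn.
  apply: (ex_intro _ _ (And3 (@open_interior _ _) (nbhs_singleton nU) _)).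
  by move=> y /set_mem/interior_subset -> ; rewrite mxE ord1.
exists U; split=> //; apply: (@Ck_eq _ _ _ _ (fun y => y 0 j + n 0 j)) => //.
  by move=> y yU; rewrite UE.
apply: (@smooth_coord _ _ _ (fun t => t + n 0 j)) => l.
by apply: C1kD; [exact: C1k_id|exact: C1k_cst].
Qed.

Lemma torus_cover p : exists u, chart_dom (tchart u) p.
Proof. by have [x <-] := tpi_surj p; exists x, x => //; exact: box_center. Qed.

Definition torus_manifold : manifold R m :=
  Manifold torus_hausdorff (compact_second_countable torus_compact)
    torus_cover transition_smooth.

End Torus.

(** * Tensors on the torus as periodic functions *)

Section TorusTensors.
Variables (R : realType) (m : nat).
Local Notation X := (torus_manifold R m).
Local Notation img i := (chart_img (@man_chart R m X i)).
Local Notation ovl i j := (overlap (@man_chart R m X i) (@man_chart R m X j)).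
Local Notation tr i j := (transition (@man_chart R m X i) (@man_chart R m X j)).

Definition lattice_periodic (T : Type) (A : 'rV[R]_m -> T) : Prop :=
  forall x n, lattice n -> A (x + n) = A x.

Definition field_of p q (A : 'rV[R]_m -> 'M[R]_(p, q)) : components X p q :=
  fun _ => A.

Lemma torus_imgE i : img i = box i. Proof. exact: tchart_imgE. Qed.

Lemma torus_ovlP i j x : ovl i j x ->
  [/\ box i x, box j (tr i j x) & exists2 n, lattice n & tr i j x = x + n].
Proof.
move=> ijx; have : overlap (tchart i) (tchart j) x by [].
rewrite overlapE => -[ix [n ln jn]].
have t : tr i j x = x + n by exact: (transitionE i ln jn).
by rewrite t; split=> //; exists n.
Qed.

Lemma torus_jacobian i j x : ovl i j x -> jacobian (tr i j) x = 1%:M.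
Proof. exact: jacobian_transition. Qed.

Lemma periodic_tr (T : Type) (A : 'rV[R]_m -> T) i j x :
  lattice_periodic A -> ovl i j x -> A (tr i j x) = A x.
Proof. by move=> pA /torus_ovlP[_ _ [n ln ->]]; exact: pA. Qed.

Lemma smooth_field_of p q (A : 'rV[R]_m -> 'M[R]_(p, q)) :
  smooth_mx_on setT A -> smooth_components (field_of A).
Proof. by move=> sA i a b k; apply: Ck_subset (sA a b k). Qed.

Lemma is_endo_field_of A : smooth_mx_on setT A -> lattice_periodic A ->
  is_endo (field_of A : components X m m).
Proof.
move=> sA pA; split; first exact: smooth_field_of.
by move=> i j x ijx; rewrite torus_jacobian// mul1mx mulmx1 /field_of periodic_tr.
Qed.

Lemma is_form1_field_of b : smooth_mx_on setT b -> lattice_periodic b ->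
  is_form1 (field_of b : components X 1 m).
Proof.
move=> sA pA; split; first exact: smooth_field_of.
by move=> i j x ijx; rewrite torus_jacobian// trmx1 mulmx1 /field_of periodic_tr.
Qed.

Lemma closed2_field_of A : smooth_mx_on setT A -> lattice_periodic A ->
  (forall x, (A x)^T = - A x) ->
  (forall x j k l, partial j (fun y => A y k l) x + partial k (fun y => A y l j) x
    + partial l (fun y => A y j k) x = 0) ->
  closed2 (field_of A : components X m m).
Proof.
move=> sA pA tA dA; split; last by move=> i x _ j k l; exact: dA.
split; [exact: smooth_field_of|by move=> i x _; exact: tA|].
by move=> i j x ijx; rewrite torus_jacobian// trmx1 mulmx1 mul1mx /field_of periodic_tr.
Qed.

Section Glue.
Variables (p q : nat) (F : components X p q).
Hypothesis F_glue : forall i j x, ovl i j x -> F i x = F j (tr i j x).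

(* The value at [x], read in the chart centred at [x]. *)
Definition glue : 'rV[R]_m -> 'M[R]_(p, q) := fun x => F x x.

Lemma glueE i x : box i x -> glue x = F i x.
Proof.
move=> ix; have ixx : ovl i x x.
  have : overlap (tchart i) (tchart x) x.
    (* Passing from chart [i] to the chart centred at [x] moves [x] by the lattice vector 0, so both
       charts give the same value there. *)
    by rewrite overlapE; split=> //; exists 0; [exact: lattice0|rewrite addr0; exact: box_center].
  by [].
have t : tr i x x = x + 0.
  by apply: (@transitionE R m i x x 0 (lattice0 _ _)); rewrite addr0; exact: box_center.
by rewrite (F_glue ixx) t addr0.
Qed.

Lemma glue_periodic : lattice_periodic glue.
Proof.
move=> x n ln; have xn : ovl x (x + n) x.
  have : overlap (tchart x) (tchart (x + n)) x.
    by rewrite overlapE; split; [exact: box_center|exists n => //; exact: box_center].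
  by [].
have t : tr x (x + n) x = x + n.
  by apply: (@transitionE R m x (x + n) x n ln); exact: box_center.
by rewrite /glue (F_glue xn) t.
Qed.

Lemma glue_eq_in i a b : {in box i, (fun y => F i y a b) =1 (fun y => glue y a b)}.
Proof. by move=> y /set_mem iy; rewrite (glueE iy). Qed.

Lemma smooth_glue : smooth_components F -> smooth_mx_on setT glue.
Proof.
move=> sF a b k; apply: Ck_local => x _; exists (box x).
split; [exact: box_open|exact: box_center|].
apply: Ck_eq (@glue_eq_in x a b) _; first exact: box_open.
by have := sF x a b k; rewrite torus_imgE.
Qed.

Lemma partial_glue i x a b k : box i x ->
  partial k (fun y => F i y a b) x = partial k (fun y => glue y a b) x.
Proof.
move=> ix; apply: near_eq_partial.
exact: open_eq_near (@box_open _ _ i) ix (@glue_eq_in i a b).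
Qed.

End Glue.

Lemma exact2_glue (a : components X m m) : exact2 a ->
  exists b : 'rV[R]_m -> 'rV[R]_m, [/\ smooth_mx_on setT b, lattice_periodic b &
    forall i x, box i x -> forall j k, a i x j k =
      partial j (fun y => b y 0 k) x - partial k (fun y => b y 0 j) x].
Proof.
move=> [b [sb tb] ab].
have gb i j x : ovl i j x -> b i x = b j (tr i j x).
  by move=> ijx; rewrite (tb _ _ _ ijx) torus_jacobian// trmx1 mulmx1.
exists (glue b); split; [exact: smooth_glue|exact: glue_periodic|].
move=> i x ix j k; rewrite ab ?torus_imgE// mxE.
by rewrite !(partial_glue gb _ _ _ ix).
Qed.

Lemma exact2_field_of (A : 'rV[R]_m -> 'M[R]_m) (b : 'rV[R]_m -> 'rV[R]_m) :
  smooth_mx_on setT b -> lattice_periodic b ->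
  (forall x j k, A x j k = partial j (fun y => b y 0 k) x - partial k (fun y => b y 0 j) x) ->
  exact2 (field_of A : components X m m).
Proof.
move=> sb pb Ab; exists (field_of b); first exact: is_form1_field_of.
by move=> i x _; apply/matrixP => j k; rewrite mxE Ab.
Qed.

Lemma closed2_glue (a : components X m m) : closed2 a ->
  exists A : 'rV[R]_m -> 'M[R]_m, [/\ smooth_mx_on setT A, lattice_periodic A,
    forall i x, box i x -> a i x = A x &
    forall x j k l, partial j (fun y => A y k l) x + partial k (fun y => A y l j) x
      + partial l (fun y => A y j k) x = 0].
Proof.
move=> [[sa _ ta] da].
have ga i j x : ovl i j x -> a i x = a j (tr i j x).
  by move=> ijx; rewrite (ta _ _ _ ijx) torus_jacobian// trmx1 mulmx1 mul1mx.
exists (glue a); split; [exact: smooth_glue|exact: glue_periodic| |].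
  by move=> i x ix; rewrite (glueE ga ix).
move=> x j k l; have xx := box_center x.
have := da x x; rewrite torus_imgE => /(_ xx j k l); rewrite /d2.
by rewrite !(partial_glue ga _ _ _ xx).
Qed.

Lemma exact2_0 (a : components X m m) : (forall i x, a i x = 0) -> exact2 a.
Proof.
move=> a0; exists (field_of (fun=> 0)).
  apply: is_form1_field_of => //; move=> i j.
  by rewrite (_ : (fun=> _) = fun=> 0); [exact: smooth_cst|apply/funext => x; rewrite mxE].
move=> i x _; rewrite a0; apply/matrixP => j k; rewrite !mxE /field_of.
have p0 l n : partial l (fun _ : 'rV[R]_m => (0 : 'rV[R]_m) 0 n) x = 0 by exact: derive_cst.
by rewrite !p0 subrr.
Qed.

Lemma exact2D (a b : components X m m) : exact2 a -> exact2 b ->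
  exact2 (fun i x => a i x + b i x).
Proof.
move=> [u [su tu] au] [v [sv tv] bv]; exists (fun i x => u i x + v i x).
  split=> [i j k l|i j x ijx]; last by rewrite (tu _ _ _ ijx) (tv _ _ _ ijx) mulmxDl.
  have oi : open (img i) by rewrite torus_imgE; exact: box_open.
  rewrite (_ : (fun x => _) = fun x => u i x j k + v i x j k).
    by apply: CkD => //; [exact: su|exact: sv].
  by apply/funext => x; rewrite mxE.
move=> i x ix; rewrite au// bv//; apply/matrixP => j k; rewrite !mxE.
have D l n : partial l (fun y => (u i y + v i y) 0 n) x =
    partial l (fun y => u i y 0 n) x + partial l (fun y => v i y 0 n) x.
  rewrite -partialD.
  - by congr (partial l _ x); apply/funext => y; rewrite mxE.
  - by have [_ /(_ l)[+ _]] := su i 0 n 1%N; exact.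
  - by have [_ /(_ l)[+ _]] := sv i 0 n 1%N; exact.
by rewrite !D; ring.
Qed.

(** The two exactness hypotheses give the two inclusions, each by additivity of exact forms. *)
Lemma exact2_class2 (a b : components X m m) : closed2 a -> closed2 b ->
  exact2 (fun i x => a i x - b i x) -> exact2 (fun i x => b i x - a i x) ->
  class2 a = class2 b.
Proof.
move=> ca cb ab ba; apply/seteqP; split=> c [cc ec]; split=> //.
  have -> : (fun i x => c i x - b i x) = (fun i x => (c i x - a i x) + (a i x - b i x)).
    by apply/funext => i; apply/funext => x; rewrite subrKA.
  exact: exact2D.
have -> : (fun i x => c i x - a i x) = (fun i x => (c i x - b i x) + (b i x - a i x)).
  by apply/funext => i; apply/funext => x; rewrite subrKA.
exact: exact2D.
Qed.

Lemma class2_eq (a b : components X m m) : closed2 a -> class2 a = class2 b ->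
  exact2 (fun i x => a i x - b i x).
Proof.
move=> ca ab; have : class2 a a by split=> //; apply: exact2_0 => i x; rewrite subrr.
by rewrite ab => -[].
Qed.

End TorusTensors.

(** * The structure K on the 4-torus *)

Section FourMatrices.
Variable F : realFieldType.

Definition c0 : 'I_(2 * 2) := @Ordinal (2 * 2) 0 isT.
Definition c1 : 'I_(2 * 2) := @Ordinal (2 * 2) 1 isT.
Definition c2 : 'I_(2 * 2) := @Ordinal (2 * 2) 2 isT.
Definition c3 : 'I_(2 * 2) := @Ordinal (2 * 2) 3 isT.

Lemma ord4P (P : 'I_(2 * 2) -> Prop) : P c0 -> P c1 -> P c2 -> P c3 -> forall i, P i.
Proof.
move=> p0 p1 p2 p3 [[|[|[|[|//]]]] h].
- by rewrite (_ : Ordinal h = c0)//; exact: val_inj.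
- by rewrite (_ : Ordinal h = c1)//; exact: val_inj.
- by rewrite (_ : Ordinal h = c2)//; exact: val_inj.
- by rewrite (_ : Ordinal h = c3)//; exact: val_inj.
Qed.

Lemma sum4 (V : nmodType) (f : 'I_(2 * 2) -> V) : \sum_i f i = f c0 + f c1 + f c2 + f c3.
Proof.
rewrite !big_ord_recl big_ord0 addr0 !addrA.
by congr (f _ + f _ + f _ + f _); exact: val_inj.
Qed.

(** Row [i] is the image of the i-th basis vector, in accordance with [v *m K]. The upper block has
    trace 0 and determinant -1 for every [k], which is why the square is the identity. *)
Definition Kmx (k : F) : 'M[F]_(2 * 2) := \matrix_(i, j)
  nth 0 (nth [::] [:: [:: k; 1; 0; 0]; [:: 1 - k ^+ 2; - k; 0; 0];
                      [:: 0; 0; 1; 0]; [:: 0; 0; 0; - 1]] i) j.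

Definition wedge (i j : 'I_(2 * 2)) : 'M[F]_(2 * 2) := delta_mx i j - delta_mx j i.

Lemma wedgeT i j : (wedge i j)^T = - wedge i j.
Proof. by rewrite /wedge linearB /= !trmx_delta opprB. Qed.

Lemma Kmx_sqr k : Kmx k *m Kmx k = 1%:M.
Proof.
apply/matrixP; apply: ord4P; apply: ord4P; rewrite !mxE sum4 !mxE /=; ring.
Qed.

Lemma mulKmx (v : 'rV[F]_(2 * 2)) k : v *m Kmx k =
  \row_j nth 0 [:: v 0 c0 * k + v 0 c1 * (1 - k ^+ 2); v 0 c0 - v 0 c1 * k; v 0 c2; - v 0 c3] j.
Proof.
apply/rowP; apply: ord4P; rewrite !mxE sum4 !mxE /=; ring.
Qed.

(** The factors [1 - s] and [1 + s] treat both eigenvalues at once: exactly one of them is zero. The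
    first coordinate of the eigenvector equation follows from the second and [s ^+ 2 = 1]. *)
Lemma Kmx_eigenP (v : 'rV[F]_(2 * 2)) k s : s ^+ 2 = 1 ->
  v *m Kmx k = s *: v <->
  [/\ v 0 c0 = (k + s) * v 0 c1, (1 - s) * v 0 c2 = 0 & (1 + s) * v 0 c3 = 0].
Proof.
move=> s2; rewrite mulKmx; split=> [/rowP h|[h0 h2 h3]].
  by move: (h c1) (h c2) (h c3); rewrite !mxE /= => h1 h2 h3; split; lra.
apply/rowP; apply: ord4P; rewrite !mxE /=.
- rewrite h0; have -> : s * ((k + s) * v 0 c1) = (s * k + s ^+ 2) * v 0 c1 by ring.
  rewrite s2; ring.
- rewrite h0; ring.
- lra.
- lra.
Qed.

Lemma congr_wedgeE (K : 'M[F]_(2 * 2)) i j a b :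
  (K *m wedge i j *m K^T) a b = K a i * K b j - K a j * K b i.
Proof.
have dE i' j' : (K *m delta_mx i' j' *m K^T) a b = K a i' * K b j'.
  rewrite -(mul_delta_mx (0 : 'I_1)) mulmxA -colE -mulmxA -rowE mxE big_ord1.
  by rewrite !mxE.
by rewrite /wedge mulmxBr mulmxBl mxE dE mxE dE.
Qed.

(** Where [k] is 1 or -1 the second term vanishes and dx^dz is an eigenform for the eigenvalue
    [k]. *)
Lemma act_wedge02 k : Kmx k *m wedge c0 c2 *m (Kmx k)^T =
  k *: wedge c0 c2 + (1 - k ^+ 2) *: wedge c1 c2.
Proof.
apply/matrixP; apply: ord4P; apply: ord4P;
  rewrite congr_wedgeE !mxE /=; ring.
Qed.

Definition omega4 : 'M[F]_(2 * 2) := wedge c0 c1 + wedge c2 c3.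

(** Both diagonal 2 x 2 blocks of [Kmx k] have determinant -1, and an area form on a plane is
    multiplied by the determinant. *)
Lemma act_omega4 k : Kmx k *m omega4 *m (Kmx k)^T = - omega4.
Proof.
rewrite mulmxDr mulmxDl; apply/matrixP; apply: ord4P; apply: ord4P;
  rewrite mxE !congr_wedgeE !mxE /=; ring.
Qed.

(** Provides an inverse of [omega4], whence nondegeneracy. *)
Lemma omega4_sqr : omega4 *m omega4 = - 1%:M.
Proof.
apply/matrixP; apply: ord4P; apply: ord4P; rewrite !mxE sum4 !mxE /=; ring.
Qed.

(** When [k ^+ 2 = 1], e_y is an eigenvector for [- k] and e_w one for -1, so the (y, w)-component
    is multiplied by the product [k]. *)
Lemma act13 k (A : 'M[F]_(2 * 2)) : k ^+ 2 = 1 ->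
  (Kmx k *m A *m (Kmx k)^T) c1 c3 = k * A c1 c3.
Proof.
move=> k2; rewrite mxE sum4 !mxE !sum4 !mxE /= k2; ring.
Qed.

Lemma ord2P (P : 'I_2 -> Prop) : P ord0 -> P ord_max -> forall i, P i.
Proof.
move=> p0 p1 [[|[|//]] h].
- by rewrite (_ : Ordinal h = ord0)//; exact: val_inj.
- by rewrite (_ : Ordinal h = ord_max)//; exact: val_inj.
Qed.

Definition eigen_basis (k s : F) (c : 'I_(2 * 2)) : 'M[F]_(2, 2 * 2) :=
  \matrix_(i, j) (if i == ord0 then (k + s) * (j == c0)%:R + (j == c1)%:R else (j == c)%:R).

Lemma eigen_basis_free k s (c : 'I_(2 * 2)) : (1 < c)%N -> row_free (eigen_basis k s c).
Proof.
move=> lt1c; apply/row_freeP.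
(* This right inverse reads off the coordinates [c1] and [c], where the basis is the identity matrix
   because [c] is neither [c0] nor [c1]. *)
exists (\matrix_(i, j) (if j == ord0 then (i == c1)%:R else (i == c)%:R)).
apply/matrixP; apply: ord2P; apply: ord2P; rewrite !mxE sum4 !mxE /=;
  move: c lt1c; apply: ord4P => //= _; ring.
Qed.

(** The two independent s-eigenvectors bound the rank below. Above, the (-s)-eigenvectors lie in the
    image of [Kmx k - s], which scales them by [- s - s]; that image has rank at least 2, so the
    kernel has rank at most 2. *)
Lemma rank_eigenspace_Kmx k s (c c' : 'I_(2 * 2)) : s ^+ 2 = 1 -> (1 < c)%N -> (1 < c')%N ->
  eigen_basis k s c *m Kmx k = s *: eigen_basis k s c ->
  eigen_basis k (- s) c' *m Kmx k = - s *: eigen_basis k (- s) c' ->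
  \rank (eigenspace (Kmx k) s) = 2%N.
Proof.
move=> s2 hc hc' hB hB'.
have s0 : - s - s != 0.
  rewrite -opprD oppr_eq0 -mulr2n mulrn_eq0 /=.
  by apply: contra_eq_neq s2 => ->; rewrite expr0n eq_sym oner_eq0.
have r B : row_free (B : 'M[F]_(2, 2 * 2)) -> \rank B = 2%N by move/eqP.
have le1 : (eigen_basis k s c <= eigenspace (Kmx k) s)%MS by exact/eigenspaceP.
have le2 : (eigen_basis k (- s) c' <= Kmx k - s%:M)%MS.
  apply/submxP; exists ((- s - s)^-1 *: eigen_basis k (- s) c').
  rewrite -scalemxAl mulmxBr hB' mul_mx_scalar -scalerBl scalerA mulVf// scale1r.
  by [].
have := mxrankS le1; have := mxrankS le2.
rewrite !r ?eigen_basis_free// /eigenspace mxrank_ker; move: (\rank _) => d.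
by move=> h1 h2; apply/eqP; rewrite eqn_leq h2 andbT leq_subLR (leq_add h1).
Qed.

Lemma rank_eigenspace_Kmx1 k : \rank (eigenspace (Kmx k) 1) = 2%N.
Proof.
apply: (@rank_eigenspace_Kmx _ _ c2 c3) => //; first by rewrite expr1n.
  by apply/matrixP; apply: ord2P; apply: ord4P; rewrite !mxE sum4 !mxE /=; ring.
by apply/matrixP; apply: ord2P; apply: ord4P; rewrite !mxE sum4 !mxE /=; ring.
Qed.

Lemma rank_eigenspace_KmxN1 k : \rank (eigenspace (Kmx k) (- 1)) = 2%N.
Proof.
apply: (@rank_eigenspace_Kmx _ _ c3 c2) => //; first by rewrite sqrrN expr1n.
  by apply/matrixP; apply: ord2P; apply: ord4P; rewrite !mxE sum4 !mxE /=; ring.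
by apply/matrixP; apply: ord2P; apply: ord4P; rewrite !mxE sum4 !mxE /=; ring.
Qed.

End FourMatrices.

(** * Averages of periodic functions over one and two coordinate circles *)

Section PeriodicMeans.
Variables (R : realType) (m : nat).
Implicit Types (u v : 'rV[R]_m -> R) (x n : 'rV[R]_m).

Lemma mean_periodic i (L : R) u : lattice_periodic u -> lattice_periodic (mean i L u).
Proof.
move=> pu x n ln; rewrite /mean; apply: eq_Rintegral => t _.
rewrite addrAC; exact: pu.
Qed.

Lemma mean_partial_eq0 i u : smooth_on setT u -> lattice_periodic u ->
  forall x, mean i 1 (partial i u) x = 0.
Proof.
move=> su pu x; rewrite (mean_partial_self _ ltr01 x (su 1%N)).
by rewrite scale1r (pu x _ (lattice_delta R i)) subrr.
Qed.

Definition mean2 i j u := mean j 1 (mean i 1 u).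

Lemma smooth_mean2 i j u : smooth_on setT u -> smooth_on setT (mean2 i j u).
Proof. by move=> su; apply: smooth_mean => //; exact: smooth_mean. Qed.

Lemma smooth_contT u : smooth_on setT u -> continuous u.
Proof. by move=> su; exact: Ck_contT (su 0%N). Qed.

Lemma mean2D i j u v x : smooth_on setT u -> smooth_on setT v ->
  mean2 i j (fun y => u y + v y) x = mean2 i j u x + mean2 i j v x.
Proof.
move=> su sv; rewrite /mean2 -meanD//;
  try by apply: smooth_contT; apply: smooth_mean.
congr (mean _ _ _ x); apply/funext => y; apply: meanD => //; exact: smooth_contT.
Qed.

Lemma mean2_cst i j c x : mean2 i j (cst c) x = c.
Proof.
rewrite /mean2 (_ : mean i 1 (cst c) = cst c) ?mean_cst ?mulr1//.
by apply/funext => y; rewrite mean_cst// mulr1.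
Qed.

Lemma mean2_partial_l i j u x : smooth_on setT u -> lattice_periodic u ->
  mean2 i j (partial i u) x = 0.
Proof.
move=> su pu; rewrite /mean2 (_ : mean i 1 _ = cst 0) ?mean_cst ?mul0r//.
by apply/funext => y; exact: mean_partial_eq0.
Qed.

Lemma mean2_partial i j l u x : smooth_on setT u ->
  mean2 i j (partial l u) x = partial l (mean2 i j u) x.
Proof.
move=> su; rewrite /mean2 (partial_mean _ ltr01 _ _ (smooth_mean _ ltr01 su 1%N)).
congr (mean _ _ _ x); apply/funext => y; by rewrite (partial_mean _ ltr01 _ _ (su 1%N)).
Qed.

Lemma mean2_partial_r i j u x : smooth_on setT u -> lattice_periodic u ->
  mean2 i j (partial j u) x = 0.
Proof.
move=> su pu; rewrite /mean2 (_ : mean i 1 _ = partial j (mean i 1 u)).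
  apply: mean_partial_eq0; first exact: smooth_mean.
  exact: mean_periodic.
by apply/funext => y; by rewrite (partial_mean _ ltr01 _ _ (su 1%N)).
Qed.

(** Integrating along [i] and [j] never leaves the hyperplane on which coordinate [k] is that of
    [x]. *)
Lemma mean2_slice i j k u x : k != i -> k != j ->
  (forall y : 'rV[R]_m, y 0 k = x 0 k -> u y = 0) -> mean2 i j u x = 0.
Proof.
move=> ki kj u0.
have mean0 l (v : 'rV[R]_m -> R) y :
    (forall t, v (y + t *: delta_mx 0 l) = 0) -> mean l 1 v y = 0.
  move=> v0; have -> : mean l 1 v y = mean l 1 (cst 0) y.
    by apply: eq_Rintegral => t _; exact: v0.
  by rewrite mean_cst// mul0r.
apply: (mean0) => t; apply: (mean0) => s; apply: u0.
by rewrite !mxE (negbTE ki) (negbTE kj) !andbF !mulr0 !addr0.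
Qed.

Lemma partial_eq0_line u k : smooth_on setT u ->
  (forall x, partial k u x = 0) -> forall x s, u (s *: delta_mx 0 k + x) = u x.
Proof.
move=> su pu x s.
have d t : is_derive t (1 : R) (fun h : R => u (h *: delta_mx 0 k + x)) 0.
  by rewrite -(pu (t *: delta_mx 0 k + x)); apply: partial_line; exact: su.
have := is_derive_0_is_cst s 0 d; by rewrite scale0r add0r.
Qed.

End PeriodicMeans.

(** A primitive of a nonnegative function is nondecreasing; being periodic, it is constant on each
    period, so its derivative vanishes. *)
Lemma periodic_primitive_eq0 (R : realType) (h g : R -> R) :
  (forall t : R, is_derive t (1 : R) h (g t)) -> (forall t, 0 <= g t) ->
  (forall t, h (t + 1) = h t) -> forall t, g t = 0.
Proof.
move=> dh g0 h1 t.
have hle x y : x <= y -> h x <= h y.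
  move=> xy; rewrite -subr_ge0.
  have [|c _ ->] := @MVT_segment R h g x y xy (fun z _ => dh z).
    by apply: continuous_subspaceT; apply: derivable_continuous => z; have := dh z.
  by rewrite mulr_ge0// subr_ge0.
(* Centring the period at [t] makes [t] an interior point, so [h] is constant near [t] on both
   sides. *)
pose a := t - 2^-1; have ta : t = a + 2^-1 by rewrite /a subrK.
have hc s : a <= s -> s <= a + 1 -> h s = h a.
  by move=> as_ sa; apply/le_anti; rewrite (hle _ _ as_) -(h1 a) (hle _ _ sa).
have : is_derive t (1 : R) h 0.
  apply: (@near_eq_is_derive _ _ _ (cst (h a))).
  near=> s; rewrite hc//.
    by apply: ltW; near: s; apply: lt_nbhsr; lra.
  by apply: ltW; near: s; apply: lt_nbhsl; lra.
have dt := dh t; move=> d0.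
by rewrite -(@derive_val _ _ _ _ _ _ _ dt) (@derive_val _ _ _ _ _ _ _ d0).
Unshelve. all: by end_near. Qed.

(** * Integrability of the structure and its symplectic form *)

Section FourTorus.
Variable R : realType.
Local Notation X := (torus_manifold R (2 * 2)).
Local Notation V := 'rV[R]_(2 * 2).
Implicit Types (g : R -> R) (x y : V).

Definition K4 : components X (2 * 2)%N (2 * 2)%N :=
  field_of (fun x : V => Kmx (tilt (x 0 c0))).

Definition smooth1 g := forall k, C1k k g.

Lemma coord_periodic (T : Type) (g : R -> T) (i : 'I_(2 * 2)) :
  (forall t z, z \is a Num.int -> g (t + z) = g t) ->
  lattice_periodic (fun x : V => g (x 0 i)).
Proof. by move=> pg x n /forallP ln; rewrite mxE pg. Qed.

Lemma smooth_tilt : smooth1 (@tilt R). Proof. exact: C1k_tilt. Qed.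

Lemma smooth_Kmx : smooth_mx_on setT (fun x : V => Kmx (tilt (x 0 c0))).
Proof.
have E (a b : 'I_(2 * 2)) : exists2 g, smooth1 g &
    forall x : V, Kmx (tilt (x 0 c0)) a b = g (x 0 c0).
  have Es : smooth1 (@tilt R) by exact: C1k_tilt.
  have En : smooth1 (fun t : R => (-1) * tilt t).
    by move=> k; apply: C1kM; [exact: C1k_cst|exact: Es].
  have Eq : smooth1 (fun t : R => 1 + (-1) * (tilt t * tilt t)).
    move=> k; apply: C1kD; first exact: C1k_cst.
    by apply: C1kM; [exact: C1k_cst|apply: C1kM; exact: Es].
  have Ec (c : R) : smooth1 (cst c) by move=> k; exact: C1k_cst.
  move: a b; apply: ord4P; apply: ord4P;
    first [ by exists (@tilt R) => // x; rewrite mxE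
          | by exists (fun t : R => 1 + (-1) * (tilt t * tilt t)) => // x; rewrite mxE /= expr2 mulN1r
          | by exists (fun t : R => (-1) * tilt t) => // x; rewrite mxE /= mulN1r
          | by exists (cst 0) => // x; rewrite mxE
          | by exists (cst 1) => // x; rewrite mxE
          | by exists (cst (-1)) => // x; rewrite mxE ].
move=> a b; have [g sg gE] := E a b.
rewrite (_ : (fun x => _) = fun x => g (x 0 c0)); first exact: smooth_coord.
exact/funext.
Qed.

Lemma tilt_int (t z : R) : z \is a Num.int -> tilt (t + z) = tilt t.
Proof. by apply: periodic_int; exact: tiltD1. Qed.

Lemma hump_int (t z : R) : z \is a Num.int -> hump (t + z) = hump t.
Proof. by apply: periodic_int; exact: humpD1. Qed.

Lemma K4_eigenP (U : components X 1 (2 * 2)%N) s : s ^+ 2 = 1 ->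
  feq (fun i x => U i x *m K4 i x) (fun i x => s *: U i x) <->
  forall i x, box i x -> [/\ U i x 0 c0 = (tilt (x 0 c0) + s) * U i x 0 c1,
    (1 - s) * U i x 0 c2 = 0 & (1 + s) * U i x 0 c3 = 0].
Proof.
move=> s2; split=> H i x ix.
  by apply/Kmx_eigenP => //; apply: (H i x); rewrite torus_imgE.
by apply/Kmx_eigenP => //; apply: H; rewrite torus_imgE in ix.
Qed.

Lemma partial_eq0_on (A : set V) (f : V -> R) j x : open A -> A x ->
  (forall y, A y -> f y = 0) -> partial j f x = 0.
Proof.
move=> oA Ax f0; rewrite (_ : partial j f x = partial j (fun=> 0) x).
  exact: derive_cst.
apply: near_eq_partial; apply: (open_eq_near oA Ax) => y /set_mem; exact: f0.
Qed.

Lemma K4_involutive s : s = 1 \/ s = -1 -> eigen_involutive K4 s.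
Proof.
move=> s1; have s2 : s ^+ 2 = 1 by case: s1 => ->; ring.
move=> U W [sU _] [sW _] /(K4_eigenP _ s2) hU /(K4_eigenP _ s2) hW.
apply/(K4_eigenP _ s2) => i x ix; have oi := @box_open R _ i.
have dW (Z : components X 1 (2 * 2)%N) a j : smooth_components Z ->
    derivable (fun y => Z i y 0 a) x (delta_mx 0 j).
  move=> sZ; have [_ /(_ j)[+ _]] := sZ i 0 a 1%N; apply.
  by rewrite torus_imgE.
have d0 (Z : components X 1 (2 * 2)%N) j : smooth_components Z ->
    (forall i x, box i x -> [/\ Z i x 0 c0 = (tilt (x 0 c0) + s) * Z i x 0 c1,
    (1 - s) * Z i x 0 c2 = 0 & (1 + s) * Z i x 0 c3 = 0]) ->
    partial j (fun y => Z i y 0 c0) x =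
    (tilt (x 0 c0) + s) * partial j (fun y => Z i y 0 c1) x +
    (j == c0)%:R * derive1 (@tilt R) (x 0 c0) * Z i x 0 c1.
  move=> sZ hZ.
  have -> : partial j (fun y => Z i y 0 c0) x =
      partial j (fun y => (tilt (y 0 c0) + s) * Z i y 0 c1) x.
    apply: near_eq_partial; apply: (open_eq_near oi ix) => y /set_mem iy.
    by have [] := hZ i y iy.
  have h1 := is_derive_coord j (C1k_is_derive (x 0 c0) (smooth_tilt 1)).
  have h2 := is_deriveD h1 (is_derive_cst s x (delta_mx 0 j)).
  have h3 := is_deriveM h2 (derivableP (dW Z c1 j sZ)).
  rewrite /partial (@derive_val _ _ _ _ _ _ _ h3) addr0 /GRing.scale /=.
  by rewrite [X in _ + X = _]mulrC.
have z0 (Z : components X 1 (2 * 2)%N) a j (c : R) :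
    (forall y, box i y -> c * Z i y 0 a = 0) -> c != 0 ->
    Z i x 0 a = 0 /\ partial j (fun y => Z i y 0 a) x = 0.
  move=> hZ cn0; have Z0 y : box i y -> Z i y 0 a = 0.
    by move=> /hZ/eqP; rewrite mulf_eq0 (negbTE cn0) => /eqP.
  by split; [exact: Z0|exact: partial_eq0_on oi ix Z0].
(* For the conditions [c * Z = 0]: either [c] is 0, or the component vanishes on the whole open box
   together with its derivatives, and so does that component of the bracket. *)
have zb a (c : R) : (forall Z, (Z = U \/ Z = W) -> forall y, box i y -> c * Z i y 0 a = 0) ->
    c * lie_bracket U W i x 0 a = 0.
  move=> hc; have [->|cn0] := eqVneq c 0; first by rewrite mul0r.
  rewrite mxE big1 ?mulr0// => j _.
  have [_ ->] := z0 W a j c (hc W (or_intror erefl)) cn0.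
  have [_ ->] := z0 U a j c (hc U (or_introl erefl)) cn0.
  by rewrite !mulr0 subrr.
split.
(* Write k for [tilt]. Since it depends on x alone, the only terms violating the relation would be
   k' (U_x W_y - W_x U_y), and these cancel because U_x = (k + s) U_y and W_x = (k + s) W_y. *)
- rewrite !mxE !sum4 !(d0 U)// !(d0 W)//.
  have [-> _ _] := hU i x ix; have [-> _ _] := hW i x ix.
  rewrite /=; ring.
- by apply: zb => Z [] -> y iy; [have [] := hU i y iy|have [] := hW i y iy].
- by apply: zb => Z [] -> y iy; [have [] := hU i y iy|have [] := hW i y iy].
Qed.

Lemma K4_Dcomplex : @Dcomplex R 2 X K4.
Proof.
split; [|by apply: K4_involutive; left|by apply: K4_involutive; right].
split.
  apply: is_endo_field_of; first exact: smooth_Kmx.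
  by apply: (@coord_periodic _ (fun t => Kmx (tilt t))) => t z zi; rewrite tilt_int.
move=> i x _; split; first exact: Kmx_sqr.
  exact: rank_eigenspace_Kmx1.
exact: rank_eigenspace_KmxN1.
Qed.

Lemma closed2_const (A : 'M[R]_(2 * 2)) : A^T = - A -> closed2 (field_of (fun _ : V => A)).
Proof.
move=> tA; apply: closed2_field_of => //.
- by move=> i j; exact: smooth_cst.
- move=> x j k l; have p0 a b c : partial a (fun _ : V => A b c) x = 0 by exact: derive_cst.
  by rewrite !p0 !addr0.
Qed.

Lemma K4_Dkahler : Dkahler K4 (field_of (fun _ : V => omega4 R)).
Proof.
split; last by move=> i x _; exact: act_omega4.
split.
  by apply: closed2_const; rewrite linearD /= !wedgeT -opprD.
move=> i x _ v hv; have v0 : v *m omega4 R = 0.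
  apply/rowP => j; have := hv (delta_mx 0 j).
  by rewrite trmx_delta -colE !mxE.
by rewrite -[v]mulmx1 -[1%:M]opprK -omega4_sqr mulmxN mulmxA v0 mul0mx oppr0.
Qed.

(** * Failure of purity *)

Local Notation wedge := (wedge R).

Definition form02 g : components X (2 * 2)%N (2 * 2)%N :=
  field_of (fun x : V => g (x 0 c0) *: wedge c0 c2).

(** The coefficient varies only with x, and dx is already a factor of the form. *)
Lemma form02_closed g : smooth1 g ->
  (forall t z, z \is a Num.int -> g (t + z) = g t) -> closed2 (form02 g).
Proof.
move=> sg pg; apply: closed2_field_of.
- move=> i j k.
  rewrite (_ : (fun x => _) = fun x => wedge c0 c2 i j * g (x 0 c0)).
    exact: Ck_coord.
  by apply/funext => x; rewrite mxE mulrC.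
- by apply: (@coord_periodic _ (fun t => g t *: wedge c0 c2)) => t z zi; rewrite pg.
- by move=> x; rewrite linearZ /= wedgeT scalerN.
- move=> x j k l.
  have dE a b c : partial a (fun y : V => (g (y 0 c0) *: wedge c0 c2) b c) x =
      wedge c0 c2 b c * ((a == c0)%:R * derive1 g (x 0 c0)).
    have h := is_deriveZ (wedge c0 c2 b c)
      (is_derive_coord a (C1k_is_derive (x 0 c0) (sg 1%N))).
    rewrite (_ : (fun y => _) = wedge c0 c2 b c \*: (fun y : V => g (y 0 c0))).
      by rewrite /partial (@derive_val _ _ _ _ _ _ _ h).
    by apply/funext => y; rewrite mxE mulrC.
  rewrite !dE; move: (derive1 g _) => d; move: j k l.
  by apply: ord4P; apply: ord4P; apply: ord4P; rewrite !mxE /=; ring.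
Qed.

Lemma form02_act g (s : R) : s ^+ 2 = 1 -> (forall t, g t != 0 -> tilt t = s) ->
  feq (act2 K4 (form02 g)) (fun i x => s *: form02 g i x).
Proof.
move=> s2 gs i x _; rewrite /act2 /form02 /K4 /field_of -scalemxAr -scalemxAl act_wedge02.
have [->|/gs ->] := eqVneq (g (x 0 c0)) 0; first by rewrite !scale0r scaler0.
by rewrite s2 subrr scale0r addr0 !scalerA mulrC.
Qed.

Definition hump_shift (t : R) : R := hump (t + 2^-1).

Lemma smooth_hump : smooth1 (@hump R). Proof. exact: C1k_hump. Qed.

Lemma smooth_hump_shift : smooth1 hump_shift.
Proof.
move=> k; apply: C1k_comp; first exact: C1k_hump.
by apply: C1kD; [exact: C1k_id|exact: C1k_cst].
Qed.

Lemma hump_shift_int (t z : R) : z \is a Num.int -> hump_shift (t + z) = hump_shift t.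
Proof. by move=> zi; rewrite /hump_shift (addrAC t); exact: hump_int. Qed.

Lemma tilt_hump_shift t : hump_shift t != 0 -> tilt t = -1.
Proof. by move=> /tilt_hump; rewrite tilt_half => <-; rewrite opprK. Qed.

(* [d(gap dz)] is the difference of the forms [form02 hump_shift] and
   [form02 hump]. *)
Definition gap : V -> R := mean c0 2^-1 (fun x : V => hump (x 0 c0)).

Let half_gt0 : 0 < 2^-1 :> R. Proof. by rewrite invr_gt0. Qed.

Let smooth_hump0 : smooth_on setT (fun x : V => hump (x 0 c0)).
Proof. exact: smooth_coord smooth_hump. Qed.

Lemma gap_smooth : smooth_on setT gap.
Proof. exact: smooth_mean. Qed.

Lemma gap_periodic : lattice_periodic gap.
Proof. by apply: mean_periodic; apply: coord_periodic; exact: hump_int. Qed.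

Lemma partial_gap j x :
  partial j gap x = (j == c0)%:R * (hump_shift (x 0 c0) - hump (x 0 c0)).
Proof.
rewrite /gap (partial_mean _ half_gt0 _ _ (smooth_hump0 1%N)).
have [->|j0] := eqVneq j c0.
  rewrite (mean_partial_self _ half_gt0 _ (smooth_hump0 1%N)) mul1r.
  by rewrite !mxE /= mulr1.
rewrite mul0r (_ : partial j _ = cst 0); first by rewrite mean_cst// mul0r.
by apply/funext => y; rewrite partial_coord ?(negbTE j0) ?mul0r//; exact: smooth_hump.
Qed.

(** Used with [c] equal to 1 and to -1, for the two differences that [exact2_class2] asks for. *)
Lemma gap_exact (c : R) g : (forall t, g t = c * (hump_shift t - hump t)) ->
  exact2 (form02 g).
Proof.
move=> gE; have oT : open [set: V] by exact: openT.
have dgap j x : derivable gap x (delta_mx 0 j).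
  by have [_ /(_ j)[+ _]] := gap_smooth 1%N; exact.
apply: (@exact2_field_of _ _ _ (fun x => (c * gap x) *: delta_mx 0 c2)).
- move=> i j k; rewrite (_ : (fun x => _) = fun x : V => (j == c2)%:R * c * gap x).
    by apply: CkZ => //; exact: gap_smooth.
  by apply/funext => x; rewrite !mxE ord1 eqxx /= mulrC mulrA.
- by move=> x n ln; rewrite gap_periodic.
- move=> x j k.
  have pE a b : partial a (fun y : V => ((c * gap y) *: delta_mx 0 c2 : V) 0 b) x =
      (b == c2)%:R * c * ((a == c0)%:R * (hump_shift (x 0 c0) - hump (x 0 c0))).
    rewrite -partial_gap -partialZ//; congr (partial a _ x); apply/funext => y.
    by rewrite !mxE eqxx /= mulrC mulrA.
  rewrite !pE gE !mxE; move: (hump_shift _ - _) => d.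
  by move: j k; apply: ord4P; apply: ord4P; rewrite /=; ring.
Qed.

Lemma class_hump : class2 (form02 (@hump R)) = class2 (form02 hump_shift).
Proof.
apply: exact2_class2.
- exact: form02_closed smooth_hump hump_int.
- exact: form02_closed smooth_hump_shift hump_shift_int.
- have [b hb dab] := @gap_exact (-1) (fun t => hump t - hump_shift t) ltac:(by move=> t; ring).
  by exists b => // i x ix; rewrite -dab// /form02 /field_of scalerBl.
- have [b hb dab] := @gap_exact 1 (fun t => hump_shift t - hump t) ltac:(by move=> t; ring).
  by exists b => // i x ix; rewrite -dab// /form02 /field_of scalerBl.
Qed.

Lemma form02_hump_not_exact : ~ exact2 (form02 (@hump R)).
Proof.
move=> /exact2_glue[b [sb pb hb]].
have E (x : V) : hump (x 0 c0) =
    partial c0 (fun y => b y 0 c2) x - partial c2 (fun y => b y 0 c0) x.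
  by rewrite -(hb x x (box_center x)) !mxE /= subr0 mulr1.
(* Averaging over z removes the derivative along z, by periodicity, and leaves [hump] unchanged,
   since it depends on x alone. *)
pose h := mean c2 1 (fun y : V => b y 0 c2).
have sh : smooth_on setT h by exact: smooth_mean.
have ph : lattice_periodic h by apply: mean_periodic => x n ln; rewrite pb.
have dh (x : V) : partial c0 h x = hump (x 0 c0).
  rewrite /h (partial_mean _ ltr01 _ _ (sb 0 c2 1%N)).
  have -> : partial c0 (fun y => b y 0 c2) =
      (fun x => hump (x 0 c0) + partial c2 (fun y => b y 0 c0) x).
    by apply/funext => y; rewrite E subrK.
  rewrite meanD; last 2 first.
  - by apply: smooth_contT; exact: smooth_hump0.
  - by apply: smooth_contT; apply: smooth_partial; exact: sb.
  rewrite mean_partial_eq0; last 2 first.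
  - exact: sb.
  - by move=> y n ln; rewrite pb.
  rewrite addr0 -[RHS]mulr1 -(mean_cst c2 ltr01 _ x).
  by apply: eq_Rintegral => t _; rewrite !mxE /= mulr0 addr0.
have h0 t : hump t = 0 :> R.
  apply: (@periodic_primitive_eq0 R (fun t => h (t *: delta_mx 0 c0 + 0)) (@hump R)) => [s|s|s].
  - have -> : hump s = partial c0 h (s *: delta_mx 0 c0 + 0).
      by rewrite dh !mxE /= mulr1 addr0.
    by apply: partial_line; exact: sh.
  - exact: hump_ge0.
  - rewrite scalerDl scale1r addrAC; apply: ph; exact: lattice_delta.
by have := hump0_gt0 R; rewrite h0 ltxx.
Qed.

Lemma K4_not_pure : ~ Cinfty_pure2 K4.
Proof.
move=> pure; have ca := form02_closed smooth_hump hump_int.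
have cb := form02_closed smooth_hump_shift hump_shift_int.
have : (H2K K4 1 `&` H2K K4 (-1)) (class2 (form02 (@hump R))).
  split.
    exists (form02 (@hump R)) => //; split=> //.
    by apply: form02_act; [rewrite expr1n|exact: tilt_hump].
  rewrite class_hump; exists (form02 hump_shift) => //; split=> //.
  by apply: form02_act; [rewrite sqrrN expr1n|exact: tilt_hump_shift].
rewrite pure => /(class2_eq ca) e; apply: form02_hump_not_exact.
case: e => b hb db; exists b => // i x ix.
by rewrite -(db i x ix) subr0.
Qed.

(** * Failure of fullness *)

Lemma K4_inv13 (a : components X (2 * 2)%N (2 * 2)%N) (s : R) x :
  feq (act2 K4 a) (fun i y => s *: a i y) -> tilt (x 0 c0) ^+ 2 = 1 ->
  tilt (x 0 c0) != s -> a x x c1 c3 = 0.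
Proof.
(* At [x] the action multiplies the (y, w)-component by [tilt], by [act13], and by [s], by
   hypothesis; as the two factors differ, the component is 0. *)
move=> inv t2 ts; have := inv x x; rewrite torus_imgE => /(_ (box_center x)).
move=> /matrixP/(_ c1 c3); rewrite act13// [RHS]mxE => /eqP.
by rewrite -subr_eq0 -mulrBl mulf_eq0 subr_eq0 (negbTE ts) => /eqP.
Qed.

(** Applied to the (y, w)-component of a 2-form, this is its integral over the (y, w)-torus through
    the given point. *)
Let M := @mean2 R (2 * 2) c1 c3.

(** Stokes on the (y, w)-torus: each term is the derivative of a periodic function along an averaged
    direction. *)
Lemma mean_exact13 (b : V -> V) x : smooth_mx_on setT b -> lattice_periodic b ->
  M (fun y => partial c1 (fun z => b z 0 c3) y - partial c3 (fun z => b z 0 c1) y) x = 0.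
Proof.
move=> sb pb.
have p i : lattice_periodic (fun z => b z 0 i) by move=> y n ln; rewrite pb.
have N : M (fun y => (-1) * partial c3 (fun z => b z 0 c1) y) x = 0.
  have -> : (fun y => -1 * partial c3 (fun z => b z 0 c1) y) =
      partial c3 (fun z => -1 * b z 0 c1).
    apply/funext => y; rewrite partialZ//.
    by have [_ /(_ c3)[+ _]] := sb 0 c1 1%N; exact.
  apply: mean2_partial_r; last by move=> y n ln; rewrite pb.
  by move=> k; apply: CkZ; [exact: openT|exact: sb].
have -> : (fun y => partial c1 (fun z => b z 0 c3) y - partial c3 (fun z => b z 0 c1) y) =
    (fun y => partial c1 (fun z => b z 0 c3) y + (-1) * partial c3 (fun z => b z 0 c1) y).
  by apply/funext => y; rewrite mulN1r.
rewrite /M mean2D; last 2 first.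
- by apply: smooth_partial; exact: sb.
- by move=> k; apply: CkZ; [exact: openT|exact: smooth_partial (sb 0 c1) k].
by rewrite mean2_partial_l; [rewrite add0r; exact: N|exact: sb|exact: p].
Qed.

(** Closedness turns the x-derivative of the (y, w)-component into derivatives along y and w, whose
    averages vanish; hence the average has zero derivative along x. *)
Lemma mean_closed13 (A : V -> 'M[R]_(2 * 2)) x s : smooth_mx_on setT A ->
  lattice_periodic A ->
  (forall x j k l, partial j (fun y => A y k l) x + partial k (fun y => A y l j) x
    + partial l (fun y => A y j k) x = 0) ->
  M (fun y => A y c1 c3) (s *: delta_mx 0 c0 + x) = M (fun y => A y c1 c3) x.
Proof.
move=> sA pA dA; apply: partial_eq0_line; first exact: smooth_mean2.
move=> y; rewrite -mean2_partial//.
have p i j : lattice_periodic (fun z => A z i j) by move=> z n ln; rewrite pA.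
have sp i j k : smooth_on setT (partial i (fun z => A z j k)) by exact: smooth_partial.
have : M (fun z => partial c0 (fun y => A y c1 c3) z + partial c1 (fun y => A y c3 c0) z
    + partial c3 (fun y => A y c0 c1) z) y = 0.
  rewrite -[RHS](@mean2_cst R _ c1 c3 0 y); congr (mean2 _ _ _ y).
  by apply/funext => z; exact: dA.
rewrite /M mean2D//; last by move=> k; apply: CkD; [exact: openT|exact: sp|exact: sp].
rewrite mean2D// mean2_partial_l// mean2_partial_r//.
by rewrite !addr0.
Qed.

Lemma K4_not_full : ~ Cinfty_full2 K4.
Proof.
move=> full; pose c : components X (2 * 2)%N (2 * 2)%N := field_of (fun=> wedge c1 c3).
have cc : closed2 c by apply: closed2_const; exact: wedgeT.
have : H2dR (class2 c) by exists c.
rewrite -full => -[a [b [[ca [a' [ca' a'K] aa']] [cb [b' [cb' b'K] bb']] cab]]].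
have [u [su pu hu]] := exact2_glue (class2_eq cc cab).
have [v [sv pv hv]] := exact2_glue (class2_eq ca' aa').
have [w [sw pw hw]] := exact2_glue (class2_eq cb' bb').
have [A [sA pA aA dA]] := closed2_glue ca'.
have [B [sB pB bB dB]] := closed2_glue cb'.
pose d (f : V -> V) (y : V) :=
  partial c1 (fun z => f z 0 c3) y - partial c3 (fun z => f z 0 c1) y.
have sd f : smooth_mx_on setT f -> smooth_on setT (d f).
  move=> sf k; rewrite (_ : d f = fun y => partial c1 (fun z => f z 0 c3) y +
      (-1) * partial c3 (fun z => f z 0 c1) y).
    apply: CkD; [exact: openT|exact: smooth_partial (sf 0 c3) k|].
    by apply: CkZ; [exact: openT|exact: smooth_partial (sf 0 c1) k].
  by apply/funext => y; rewrite /d mulN1r.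
(* Combines c - (a + b) = du, a' - a = dv and b' - b = dw in the (y, w)-component, where c is 1; A
   and B are the periodic functions representing a' and b'. *)
have decomp : (fun y => (A y c1 c3 + B y c1 c3) + d u y) = (fun y => 1 + (d v y + d w y)).
  apply/funext => y; have yy := box_center y.
  have := hu y y yy c1 c3; have := hv y y yy c1 c3; have := hw y y yy c1 c3.
  rewrite -/(d u y) -/(d v y) -/(d w y) -(aA y y yy) -(bB y y yy).
  by rewrite /c /field_of !mxE /=; lra.
have s1 : smooth_on setT (fun _ : V => 1 : R) by exact: smooth_cst.
(* The average of the invariant part is moved from x = 0 to x = 1/2, where [tilt] is -1 and the
   component vanishes on the whole slice. *)
have MA : M (fun y => A y c1 c3) 0 = 0.
  rewrite -(mean_closed13 0 2^-1 sA pA dA) /M (@mean2_slice _ _ _ _ c0)// => y.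
  rewrite !mxE /= mulr1 addr0 => y0; have yh : tilt (y 0 c0) = -1.
    by rewrite y0 -[2^-1]add0r tilt_half tilt0.
  rewrite -(aA y y (box_center y)); apply: (K4_inv13 a'K); rewrite yh.
    by rewrite sqrrN expr1n.
  by apply/eqP; lra.
(* For the anti-invariant part the slice x = 0 itself works, as [tilt] is 1 there. *)
have MB : M (fun y => B y c1 c3) 0 = 0.
  rewrite /M (@mean2_slice _ _ _ _ c0)// => y; rewrite mxE => y0.
  have yh : tilt (y 0 c0) = 1 by rewrite y0 tilt0.
  rewrite -(bB y y (box_center y)); apply: (K4_inv13 b'K); rewrite yh.
    by rewrite expr1n.
  by apply/eqP; lra.
have M1 : M (fun=> 1) 0 = 1 by exact: mean2_cst.
(* Averaging the decomposition at the origin leaves 0 on the left and 1 on the right. *)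
have := congr1 (fun f => M f 0) decomp; rewrite /M /=.
rewrite mean2D//; last 2 first.
- by move=> k; apply: CkD; [exact: openT|exact: sA|exact: sB].
- exact: sd.
rewrite mean2D//.
rewrite [RHS]mean2D//; last by move=> k; apply: CkD; [exact: openT|exact: sd|exact: sd].
rewrite [in RHS]mean2D//; [|exact: sd|exact: sd].
rewrite -/M MA MB M1 !mean_exact13//; lra.
Qed.

End FourTorus.

Theorem proposition3p3 (R : realType) :
  (exists (n : nat) (X : manifold R (2 * n)%N) (K : components X (2 * n)%N (2 * n)%N),
     [/\ compact [set: X], Dcomplex K, (exists w, Dkahler K w)
       & ~ Cinfty_pure2 K])
  /\
  (exists (n : nat) (X : manifold R (2 * n)%N) (K : components X (2 * n)%N (2 * n)%N),
     [/\ compact [set: X], Dcomplex K, (exists w, Dkahler K w)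
       & ~ Cinfty_full2 K]).
Proof.
split; exists 2%N, (torus_manifold R (2 * 2)), (@K4 R); split.
- exact: torus_compact.
- exact: K4_Dcomplex.
- by eexists; exact: K4_Dkahler.
- exact: K4_not_pure.
- exact: torus_compact.
- exact: K4_Dcomplex.
- by eexists; exact: K4_Dkahler.
- exact: K4_not_full.
Qed.
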